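(* Let $k\ge1$ be an integer, let $\lambda_1,\dots,\lambda_k>0$, and let $a,b>0$. Let $\{Z(t)\}_{t\ge0}$ be the gamma subordinator with parameters $a,b$ and density $g(x,t)$, let $\{M(t)\}_{t\ge0}$ be a generalized counting process with rates $\lambda_1,\dots,\lambda_k$ independent of $Z$, with state probabilities $p(n,t)=\mathrm{Pr}\{M(t)=n\}$, and let $\mathcal Z_{f_1}(t)=M(Z(t))$. Let $\gamma\ge1$ and let $\kappa(x)=\Gamma'(x)/\Gamma(x)$ be the digamma function. Then the probability mass function $p_{f_1}(n,t)=\mathrm{Pr}\{\mathcal Z_{f_1}(t)=n\}$, $n\ge0$, solves $$D_t^\gamma p_{f_1}(n,t)=b\,D_t^{\gamma-1}\Big[\left(\log(a)-\kappa(bt)\right)p_{f_1}(n,t)\Big]+b\int_0^\infty p(n,x)\log(x)\,D_t^{\gamma-1}g(x,t)\,\mathrm dx,$$ where $D_t^\gamma$ is the Riemann–Liouville fractional derivative.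
   Context: The generalized counting process (GCP) with positive rates $\lambda_1,\dots,\lambda_k$ is the counting process $\{M(t)\}_{t\ge0}$ with $M(0)=0$ that performs $k$ kinds of jumps of amplitude $1,2,\dots,k$ with rates $\lambda_1,\dots,\lambda_k$, respectively; equivalently $M(t)=\sum_{j=1}^k jN_j(t)$ in law, where $N_1,\dots,N_k$ are independent Poisson processes with intensities $\lambda_1,\dots,\lambda_k$. The gamma subordinator with parameters $a,b>0$ is the subordinator $\{Z(t)\}_{t\ge0}$ such that $Z(t)$ has density $g(x,t)=\frac{a^{bt}}{\Gamma(bt)}x^{bt-1}e^{-ax}$, $x>0$; its Bernstein function is $f_1(s)=b\log(1+s/a)$, i.e. $\mathbb E(e^{-sZ(t)})=e^{-tf_1(s)}$, $s>0$. For $\gamma\ge0$ the Riemann–Liouville fractional derivative is $D_t^\gamma f(t)=\frac1{\Gamma(m-\gamma)}\frac{\mathrm d^m}{\mathrm dt^m}\int_0^t\frac{f(s)}{(t-s)^{\gamma+1-m}}\,\mathrm ds$ for $m-1<\gamma<m$, and $D_t^\gamma f(t)=\frac{\mathrm d^m}{\mathrm dt^m}f(t)$ for $\gamma=m$, where $m$ is a positive integer; $D_t^0$ is the identity.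
   Formalization: The equation is stated (for t>0) when every term on its right side exists, which is proved for n≥1 or integer γ; for n=0 and non-integer γ, (log a−κ(bs))p_{f_1}(0,s) behaves like 1/(bs) at 0, so D_t^{γ-1} of it is undefined and nothing is claimed. *)

(* Defs.v *)
From HB Require Import structures.
From mathcomp Require Import all_boot all_order all_algebra.
From mathcomp Require Import all_classical all_reals all_analysis.

Set Implicit Arguments.
Unset Strict Implicit.
Unset Printing Implicit Defensive.

Import Order.TTheory GRing.Theory Num.Theory.
Import numFieldNormedType.Exports.

Local Open Scope ring_scope.
Local Open Scope classical_set_scope.

Section special_functions.
Context {R : realType}.

(* Euler's integral: meaningful for 0 < z only. *)
Definition Gamma (z : R) : R :=
  \int[lebesgue_measure]_(x in `]0, +oo[) (x `^ (z - 1) * expR (- x)).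

Definition digamma (x : R) : R := derive1 Gamma x / Gamma x.

Definition gamma_density (a b x t : R) : R :=
  a `^ (b * t) / Gamma (b * t) * x `^ (b * t - 1) * expR (- (a * x)).

End special_functions.

Section Riemann_Liouville.
Context {R : realType}.

Definition RL_kernel (m : nat) (gamma : R) (f : R -> R) (t s : R) : R :=
  f s / (t - s) `^ (gamma + 1 - m%:R).

Definition RL_integral (m : nat) (gamma : R) (f : R -> R) (t : R) : R :=
  \int[lebesgue_measure]_(s in `]0, t[) RL_kernel m gamma f t s.

(* For gamma >= 0 that is not an integer, m = truncn gamma + 1 is the integer
   with m - 1 < gamma < m. *)
Definition RL_derive (gamma : R) (f : R -> R) (t : R) : R :=
  if gamma \is a Num.nat then derive1n (Num.truncn gamma) f t
  else let m := (Num.truncn gamma).+1 in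
       (Gamma (m%:R - gamma))^-1 * derive1n m (RL_integral m gamma f) t.

Definition derivable_upto (m : nat) (f : R -> R) :=
  forall t i, 0 < t -> (i < m)%N -> derivable (derive1n i f) t 1.

(* Integrals and derivatives are total in the library, with default values;
   this says that all those occurring in RL_derive gamma f t exist, for every
   t > 0. *)
Definition RL_derivable (gamma : R) (f : R -> R) : Prop :=
  if gamma \is a Num.nat then derivable_upto (Num.truncn gamma) f
  else let m := (Num.truncn gamma).+1 in
       (forall t, 0 < t -> lebesgue_measure.-integrable `]0, t[
                             (EFin \o RL_kernel m gamma f t)) /\
       derivable_upto m (RL_integral m gamma f).

End Riemann_Liouville.

(* Processes are indexed by the whole of R, but only times t >= 0 are ever
   constrained. *)
Section processes.
Context {d : measure_display} {T : measurableType d} {R : realType}.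
Variable P : probability T R.
Implicit Types X Y : R -> T -> R.

Definition increment X (s t : R) : T -> R := fun w => X t w - X s w.

(* Taking some of the B i to be setT gives the product rule for subfamilies. *)
Definition independent_increments X :=
  forall (n : nat) (t : nat -> R) (B : nat -> set R),
    0 <= t 0%N -> (forall i, t i <= t i.+1) -> (forall i, measurable (B i)) ->
    P (\bigcap_(i < n) (increment X (t i) (t i.+1) @^-1` B i)) =
    (\prod_(i < n) P (increment X (t i) (t i.+1) @^-1` B i))%E.

Definition stationary_increments X :=
  forall (s t : R) (B : set R), 0 <= s -> 0 <= t -> measurable B ->
    P (increment X s (s + t) @^-1` B) = P (increment X 0 t @^-1` B).

(* Product rule on cylinder events, a pi-system that generates the
   sigma-algebra of each process. *)
Definition independent_processes X Y :=
  forall (m n : nat) (s t : nat -> R) (A B : nat -> set R),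
    (forall i, 0 <= s i) -> (forall i, 0 <= t i) ->
    (forall i, measurable (A i)) -> (forall i, measurable (B i)) ->
    P (\bigcap_(i < m) (X (s i) @^-1` A i) `&`
       \bigcap_(j < n) (Y (t j) @^-1` B j)) =
    (P (\bigcap_(i < m) (X (s i) @^-1` A i)) *
     P (\bigcap_(j < n) (Y (t j) @^-1` B j)))%E.

Definition real_process (M : R -> T -> nat) : R -> T -> R :=
  fun t w => (M t w)%:R.

Definition pmf_at (M : R -> T -> nat) (n : nat) (t : R) : R :=
  fine (P [set w | M t w = n]).

Definition nondecreasing_paths X :=
  forall w s t, 0 <= s -> s <= t -> X s w <= X t w.

Definition right_continuous_paths X :=
  forall w t, 0 <= t -> X s w @[s --> t^'+] --> X t w.

Definition time_changed (M : R -> T -> nat) (Z : R -> T -> R) :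
  R -> T -> nat := fun t w => M (Z t w) w.

(* The index i : 'I_k stands for the jump amplitude i + 1. *)
Record generalized_counting_process (k : nat) (lambda : 'I_k -> R)
    (M : R -> T -> nat) : Prop := {
  gcp_measurable : forall t, 0 <= t -> measurable_fun setT (M t);
  gcp_start : forall w, M 0 w = 0%N;
  gcp_nondecreasing : nondecreasing_paths (real_process M);
  gcp_right_continuous : right_continuous_paths (real_process M);
  gcp_independent : independent_increments (real_process M);
  gcp_stationary : stationary_increments (real_process M);
  gcp_rate : forall i : 'I_k,
    pmf_at M i.+1 h / h @[h --> 0^'+] --> lambda i;
  gcp_large_jump :
    fine (P [set w | (k < M h w)%N]) / h @[h --> 0^'+] --> (0 : R) }.

Record gamma_subordinator (a b : R) (Z : R -> T -> R) : Prop := {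
  gs_measurable : forall t, 0 <= t -> measurable_fun setT (Z t);
  gs_start : forall w, Z 0 w = 0;
  gs_nondecreasing : nondecreasing_paths Z;
  gs_right_continuous : right_continuous_paths Z;
  gs_independent : independent_increments Z;
  gs_stationary : stationary_increments Z;
  gs_density : forall (t : R) (B : set R), 0 < t -> measurable B ->
    P (Z t @^-1` B) =
    (\int[lebesgue_measure]_(x in B `&` `]0%R, +oo[)
       (gamma_density a b x t)%:E)%E }.

End processes.

(* Main.v *)
Require Import Defs.
From HB Require Import structures.
From mathcomp Require Import all_boot all_order all_algebra.
From mathcomp Require Import all_classical all_reals all_analysis.
From mathcomp Require Import measurable_realfun lebesgue_integral_under.
From mathcomp Require Import ring lra zify.
Import Order.TTheory GRing.Theory Num.Theory.
Import numFieldNormedType.Exports.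
Local Open Scope ring_scope.
Local Open Scope classical_set_scope.

(** Write [p] for the state probabilities of [M], [g] for the density of [Z t], and
    [pf] for the state probabilities of the time-changed process. Conditioning
    on [Z t], which is independent of [M], gives
      [pf n t = \int_0^oo p n x * g x t dx]                ([pmf_time_changed]),
    and [g x t = c t * x^(b t - 1) * e^(- a x)] with [c t = a^(b t) / Gamma (b t)],
    so that [c' / c = b (ln a - digamma (b t))] and
      [dg/dt = b (ln a - digamma (b t)) g + b (ln x) g].
    Integrating against [p n] gives the equation of order 1,
      [pf' = b F + b K], where [F t = (ln a - digamma (b t)) * pf n t] and
      [K t = \int_0^oo p n x * ln x * g x t dx].
    Applying the derivative of order [gamma - 1], it remains to exchange this
    derivative with the integral in [x] that defines [K].

    Everything takes place in one class of functions ([family]): finite sums of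
    terms [c t * (ln x)^i * x^(b t + e - 1) * e^(- a x)] with [c] smooth. The
    class is closed under derivation in [t], and integration in [x] against a
    bounded weight [q] commutes with derivation in [t], because the [x]-integrals
    are Mellin transforms and each of them is dominated, locally uniformly in
    [t], by a multiple of a log-logistic density. This settles integer [gamma].

    For fractional [gamma], with fractional part [alpha], the Riemann-Liouville
    integral of order [1 - alpha] starts at time 0, and two facts are needed
    there. First,
    [Gamma (b t + 1) = b t * Gamma (b t)] shows that [c] extends smoothly to
    negative [t], with [c 0 = 0]; and for [n > 0] the transition rates give
    [p n x <= C x], so that [p n x / x] is a bounded weight and the exponent of
    [x] gains 1. Hence [pf] and [K], and therefore [F = pf' / b - K], extend
    smoothly across 0, the pole of the digamma function notwithstanding.
    Secondly, [pf n 0 = 0], so the integral commutes with one derivative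
    ([derive1_fracI0]). The substitution [s = t v] turns the Riemann-Liouville
    integral into [t^(1 - alpha)] times an integral over a fixed interval, which
    shows that it maps smooth functions to smooth functions and that its [n]-th
    derivative is [t^(- n)] times the Riemann-Liouville integral of another
    function in the same class ([derive1n_fracI]); Fubini's theorem then
    exchanges it with the integral in [x].

    For [n = 0] and fractional [gamma] the right-hand side does not exist:
    [pf 0 t] tends to 1 at 0 while [- digamma (b t)] grows like [1 / (b t)], so
    [F] is not integrable near 0 ([F_kernel_not_integrable]). *)

Set Implicit Arguments.
Unset Strict Implicit.
Unset Printing Implicit Defensive.

(** * Derivatives of all orders on a half-line *)

Section derivatives.
Context {R : realType}.
Implicit Types (f g : R -> R) (x u : R).

Lemma is_derive_add f g x df dg :
  is_derive x 1 f df -> is_derive x 1 g dg ->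
  is_derive x 1 (fun y => f y + g y) (df + dg).
Proof. by move=> hf hg; have := is_deriveD hf hg. Qed.

Lemma is_derive_mul f g x df dg :
  is_derive x 1 f df -> is_derive x 1 g dg ->
  is_derive x 1 (fun y => f y * g y) (df * g x + f x * dg).
Proof.
move=> hf hg; have h := is_deriveM hf hg.
by apply: is_derive_eq h _; rewrite /GRing.scale /= addrC [g x * _]mulrC.
Qed.

Lemma is_derive_scale (k : R) f x df :
  is_derive x 1 f df -> is_derive x 1 (fun y => k * f y) (k * df).
Proof. by move=> hf; have := is_deriveZ k hf. Qed.

Lemma is_derive_affine (k e x : R) : is_derive x 1 (fun y => k * y + e) k.
Proof.
have h : is_derive x 1 (fun y : R => y) 1 by exact: is_derive_id.
have := is_derive_add (is_derive_scale k h) (is_derive_cst e x 1).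
by rewrite mulr1 addr0.
Qed.

Lemma is_derive_comp_affine (k e : R) f x df :
  is_derive (k * x + e) 1 f df ->
  is_derive x 1 (fun y => f (k * y + e)) (k * df).
Proof.
move=> hf; rewrite mulrC.
exact: (@is_derive1_comp _ f (fun y => k * y + e) x df k hf (is_derive_affine k e x)).
Qed.

Lemma is_derive_expR_comp f x df :
  is_derive x 1 f df ->
  is_derive x 1 (fun y => expR (f y)) (expR (f x) * df).
Proof. by move=> hf; exact: is_derive1_comp. Qed.

Lemma is_derive_inv f x df : f x != 0 ->
  is_derive x 1 f df -> is_derive x 1 (fun y => (f y)^-1) (- df * (f x)^-1 ^+ 2).
Proof.
move=> fx0 hf; have h := is_deriveV fx0 hf.
by apply: is_derive_eq h _; rewrite /GRing.scale /= exprVn !mulNr mulrC.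
Qed.

Lemma is_derive_derive1 f x : derivable f x 1 -> is_derive x 1 f (f^`() x).
Proof. by move=> h; apply: DeriveDef; [exact: h|rewrite derive1E]. Qed.

Lemma derive1_is_derive f x df : is_derive x 1 f df -> f^`() x = df.
Proof. by move=> h; rewrite derive1E; exact: derive_val. Qed.

Lemma derivable_is_derive f x df : is_derive x 1 f df -> derivable f x 1.
Proof. by case. Qed.

Lemma near_eq_gt f g u x : (forall y, u < y -> f y = g y) -> u < x ->
  {near x, f =1 g}.
Proof. by move=> fg ux; have := lt_nbhsr ux; apply: filterS. Qed.

Lemma eq_derive1_gt f g u : (forall y, u < y -> f y = g y) ->
  forall x, u < x -> f^`() x = g^`() x.
Proof.
by move=> fg x ux; rewrite !derive1E; exact/near_eq_derive/(@near_eq_gt _ _ u).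
Qed.

Lemma eq_derive1n_gt f g u n : (forall y, u < y -> f y = g y) ->
  forall x, u < x -> f^`(n) x = g^`(n) x.
Proof.
move=> fg; elim: n => [//|n ih] x ux.
by rewrite !derive1nS; exact: (eq_derive1_gt ih).
Qed.

(** Smoothness is measured on a half-line [t > u]: the case [u = 0] is what the
    Riemann-Liouville derivative asks for, and [u < 0] gives control up to the
    origin of time. *)
Definition smoothn (u : R) (n : nat) (f : R -> R) :=
  forall t i, u < t -> (i < n)%N -> derivable (f^`(i)) t 1.

Definition smooth (u : R) (f : R -> R) := forall n, smoothn u n f.

Lemma smoothnS u n f : smoothn u n.+1 f <->
  (forall t, u < t -> derivable f t 1) /\ smoothn u n f^`().
Proof.
split=> [h|[h1 h2] t [|i] ut]; last 2 first.
- by move=> _; exact: h1.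
- by rewrite ltnS derive1Sn; exact: h2.
by split=> [t ut|t i ut ti]; [exact: (h t 0%N)|rewrite -derive1Sn; exact: h].
Qed.

Lemma smoothn_le u n m f : (m <= n)%N -> smoothn u n f -> smoothn u m f.
Proof. by move=> mn h t i ut im; apply: h => //; exact: leq_trans mn. Qed.

Lemma eq_smoothn u n f g : (forall y, u < y -> f y = g y) ->
  smoothn u n f -> smoothn u n g.
Proof.
move=> fg h t i ut im; have := h t i ut im; apply: near_eq_derivable.
by apply: (@near_eq_gt _ _ u) => // y; exact: eq_derive1n_gt.
Qed.

Lemma eq_smooth u f g : (forall y, u < y -> f y = g y) ->
  smooth u f -> smooth u g.
Proof. by move=> fg h n; exact: eq_smoothn fg (h n). Qed.

(** The induction step of all closure properties of smoothness: only the first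
    derivative has to be computed, the rest is the induction hypothesis. *)
Lemma smoothnS_derive u n f df :
  (forall t, u < t -> is_derive t 1 f (df t)) -> smoothn u n df ->
  smoothn u n.+1 f.
Proof.
move=> h1 h2; apply/smoothnS; split; first by move=> t /h1 [].
by apply: eq_smoothn h2 => y /h1/derive1_is_derive ->.
Qed.

Lemma smooth_derivable u f t : smooth u f -> u < t -> derivable f t 1.
Proof. by move=> h ut; exact: (h 1%N t 0%N). Qed.

Lemma smooth_is_derive u f t : smooth u f -> u < t -> is_derive t 1 f (f^`() t).
Proof. by move=> h ut; exact/is_derive_derive1/(smooth_derivable h). Qed.

Lemma smooth_derive1 u f : smooth u f -> smooth u f^`().
Proof. by move=> h n; have /smoothnS[] := h n.+1. Qed.

Lemma smooth_derive1n u f n : smooth u f -> smooth u f^`(n).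
Proof. by elim: n => [|n ih] h; [exact: h|exact: (smooth_derive1 (ih h))]. Qed.

Lemma smooth_cst u (k : R) : smooth u (fun=> k).
Proof.
move=> n; elim: n k => [k t i|n ih k]; first by rewrite ltn0.
by apply: (@smoothnS_derive _ _ _ (fun=> 0)) => // t _; exact: is_derive_cst.
Qed.

Lemma smoothnD u n f g : smoothn u n f -> smoothn u n g ->
  smoothn u n (fun y => f y + g y).
Proof.
elim: n f g => [f g _ _ t i|n ih f g]; first by rewrite ltn0.
move=> /smoothnS[df hf] /smoothnS[dg hg].
refine (@smoothnS_derive _ _ _ (fun t => derive1 f t + derive1 g t) _ _); last exact: ih.
by move=> t ut; exact: (is_derive_add (is_derive_derive1 (df _ ut)) (is_derive_derive1 (dg _ ut))).
Qed.

Lemma smoothnM u n f g : smoothn u n f -> smoothn u n g ->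
  smoothn u n (fun y => f y * g y).
Proof.
elim: n f g => [f g _ _ t i|n ih f g]; first by rewrite ltn0.
move=> hf0 hg0; have /smoothnS[df hf] := hf0; have /smoothnS[dg hg] := hg0.
refine (@smoothnS_derive _ _ _ (fun t => derive1 f t * g t + f t * derive1 g t) _ _).
  by move=> t ut; exact: (is_derive_mul (is_derive_derive1 (df _ ut)) (is_derive_derive1 (dg _ ut))).
exact: (smoothnD (ih _ _ hf (smoothn_le (leqnSn n) hg0))
  (ih _ _ (smoothn_le (leqnSn n) hf0) hg)).
Qed.

Lemma smoothD u f g : smooth u f -> smooth u g -> smooth u (fun y => f y + g y).
Proof. by move=> hf hg n; exact: smoothnD. Qed.

Lemma smoothM u f g : smooth u f -> smooth u g -> smooth u (fun y => f y * g y).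
Proof. by move=> hf hg n; exact: smoothnM. Qed.

Lemma smoothZ u (k : R) f : smooth u f -> smooth u (fun y => k * f y).
Proof. by move=> hf; exact: (smoothM (@smooth_cst u k) hf). Qed.

Lemma smooth_id u : smooth u (fun y => y).
Proof.
case=> [t i|n]; first by rewrite ltn0.
exact: (@smoothnS_derive _ _ _ (fun=> 1) (fun t _ => is_derive_id _ _) (@smooth_cst u 1 n)).
Qed.

Lemma smoothV u f : (forall t, u < t -> f t != 0) -> smooth u f ->
  smooth u (fun y => (f y)^-1).
Proof.
move=> f0 hf n; elim: n => [t i|n ih]; first by rewrite ltn0.
have hf' := smooth_derive1 hf.
refine (@smoothnS_derive _ _ _
  (fun t => (-1 * derive1 f t) * ((f t)^-1 * (f t)^-1)) _ _).
  move=> t ut; rewrite mulN1r -expr2.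
  exact: (is_derive_inv (f0 _ ut) (smooth_is_derive hf ut)).
by apply: smoothnM; [exact: smoothZ|exact: smoothnM].
Qed.

Lemma smooth_expR u (k : R) : smooth u (fun y => expR (k * y)).
Proof.
elim=> [t i|n ih]; first by rewrite ltn0.
refine (@smoothnS_derive _ _ _ (fun y => k * expR (k * y)) _ _).
  move=> t _; have := @is_derive_comp_affine k 0 expR t _ (is_derive_expR _).
  by rewrite addr0; under [X in is_derive _ _ X]eq_fun do rewrite addr0.
exact: (smoothnM (@smooth_cst u k n) ih).
Qed.

Lemma smooth_comp_affine (k e u v : R) f :
  (forall t, u < t -> v < k * t + e) -> smooth v f ->
  smooth u (fun y => f (k * y + e)).
Proof.
move=> uv hf n; elim: n f hf => [f _ t i|n ih f hf]; first by rewrite ltn0.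
refine (@smoothnS_derive _ _ _ (fun y => k * derive1 f (k * y + e)) _ _).
  move=> t ut; exact: (is_derive_comp_affine (smooth_is_derive hf (uv _ ut))).
apply: smoothnM; first exact: smooth_cst.
exact/ih/smooth_derive1.
Qed.

Lemma derive1nD_gt u f g n t : smooth u f -> smooth u g -> u < t ->
  derive1n n (fun y => f y + g y) t = derive1n n f t + derive1n n g t.
Proof.
move=> hf hg; elim: n t => [//|n ih] t ut; rewrite !derive1nS.
rewrite (eq_derive1_gt ih)//; apply: derive1_is_derive.
by apply: (is_derive_add (smooth_is_derive _ ut) (smooth_is_derive _ ut)); exact: smooth_derive1n.
Qed.

Lemma derive1nZ_gt u (k : R) f n t : smooth u f -> u < t ->
  derive1n n (fun y => k * f y) t = k * derive1n n f t.
Proof.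
move=> hf; elim: n t => [//|n ih] t ut; rewrite !derive1nS.
rewrite (eq_derive1_gt ih)//; apply: derive1_is_derive.
exact: (is_derive_scale k (smooth_is_derive (@smooth_derive1n u f n hf) ut)).
Qed.

Lemma smooth_continuous u f t : smooth u f -> u < t -> {for t, continuous f}.
Proof.
by move=> hf ut; apply/differentiable_continuous/derivable1_diffP/smooth_derivable/ut.
Qed.

(** Smoothness beyond the left end point [p] is what gives a bound up to [p]. *)
Lemma smooth_bounded u f (p q : R) : smooth u f -> u < p ->
  exists C, forall t, p <= t <= q -> `|f t| <= C.
Proof.
move=> hf up; have [pq|qp] := leP p q; last first.
  by exists 0 => t /andP[pt tq]; have := le_trans pt tq; rewrite leNgt qp.
have cf : {within `[p, q], continuous (fun t => `|f t|)}.
  apply: continuous_in_subspaceT => t; rewrite inE/= in_itv/= => /andP[pt _].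
  apply: (@continuous_comp _ _ _ f (fun y => `|y|)); last exact: norm_continuous.
  exact: smooth_continuous hf (lt_le_trans up pt).
have [c _ hc] := EVT_max pq cf.
by exists `|f c| => t tpq; apply: hc; rewrite in_itv.
Qed.

End derivatives.

(** * Improper integrals of derivatives, and scaling *)

Section improper.
Context {R : realType}.
Notation mu := (@lebesgue_measure R).

Lemma is_derive_continuous (f : R -> R) (x df : R) :
  is_derive x 1 f df -> {for x, continuous f}.
Proof. by move=> [h _]; exact/differentiable_continuous/derivable1_diffP. Qed.

Lemma integral_segment_derive (h h' : R -> R) (a b : R) : a < b ->
  (forall x, `[a, b] x -> is_derive x 1 h (h' x)) ->
  (forall x, `[a, b] x -> {for x, continuous h'}) ->
  (\int[mu]_(x in `[a, b]) (h' x)%:E = (h b - h a)%:E)%E.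
Proof.
move=> ab dh ch'; rewrite EFinB; apply: continuous_FTC2 => //.
- by apply: continuous_in_subspaceT => x; rewrite inE; exact: ch'.
- split.
  + move=> x xab; have xab' : `[a, b] x by exact: subset_itv_oo_cc.
    exact: (derivable_is_derive (dh x xab')).
  + apply: cvg_at_right_filter; apply: (is_derive_continuous (dh a _)).
    by rewrite /= in_itv/= lexx ltW.
  + apply: cvg_at_left_filter; apply: (is_derive_continuous (dh b _)).
    by rewrite /= in_itv/= lexx ltW.
- move=> x xab; have xab' : `[a, b] x by exact: subset_itv_oo_cc.
  exact: (derive1_is_derive (dh x xab')).
Qed.

Section exhaustion.
Variables (D : set R) (a b : nat -> R) (h h' : R -> R).
Hypothesis oD : open D.
Hypothesis ab : forall n, a n < b n.
Hypothesis abD : forall n, `[a n, b n] `<=` D.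
Hypothesis exD : forall x, D x -> \forall n \near \oo, `[a n, b n] x.
Hypothesis dh : forall x, D x -> is_derive x 1 h (h' x).
Hypothesis ch' : forall x, D x -> {for x, continuous h'}.

Let mD : measurable D := open_measurable oD.

Let f n x := (h' x * \1_(`[a n, b n]) x)%:E : \bar R.

Let mh' : measurable_fun D h'.
Proof.
by apply: open_continuous_measurable_fun => // x; rewrite inE; exact: ch'.
Qed.

Let mf n : measurable_fun D (f n).
Proof.
by apply/measurable_EFinP/measurable_funM.
Qed.

Let f_cvg x : D x -> f n x @[n --> \oo] --> (h' x)%:E.
Proof.
move=> Dx; apply: cvg_near_cst; have := exD Dx; apply: filterS => n xn.
by rewrite /f indicE mem_set// mulr1.
Qed.

Let int_f n : (\int[mu]_(x in D) f n x = (h (b n) - h (a n))%:E)%E.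
Proof.
rewrite /f; have <- := integral_segment_derive (ab n)
  (fun x xn => dh (abD xn)) (fun x xn => ch' (abD xn)).
rewrite -[in RHS](setIidr (@abD n)) integral_mkcondr; apply: eq_integral => x _.
by rewrite patchE indicE; case: ifPn => _; rewrite ?mulr1 ?mulr0.
Qed.

(** A nonnegative derivative of a bounded function is integrable on an open set
    exhausted by segments: by Fatou's lemma its integral is at most the limit of
    the increments of the primitive over these segments. *)
Lemma ge0_derive_integrable (M : R) : (forall x, D x -> 0 <= h' x) ->
  (forall x, D x -> `|h x| <= M) -> mu.-integrable D (EFin \o h').
Proof.
move=> h'0 hM; apply/integrableP; split; first exact/measurable_EFinP.
under eq_integral => x /[!inE] Dx do rewrite /= ger0_norm ?h'0//.
apply: (@le_lt_trans _ _ (M + M)%:E); last exact: ltry.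
have -> : (\int[mu]_(x in D) (h' x)%:E =
    \int[mu]_(x in D) limn_einf (f ^~ x))%E.
  by apply: eq_integral => x /[!inE] Dx; rewrite (cvg_limn_einf_sup (f_cvg Dx)).
apply: le_trans (fatou mu mD mf _) _.
  move=> n x Dx; rewrite lee_fin mulr_ge0// ?h'0//.
rewrite limn_einf_lim; apply: lime_le; first exact: is_cvg_einfs.
apply: nearW => n; apply: (@le_trans _ _ (\int[mu]_(x in D) f n x)%E).
  by apply: ereal_inf_lbound; exists n => //=.
have Dn c : a n <= c <= b n -> D c by move=> ?; apply: (@abD n); rewrite /= in_itv.
rewrite int_f lee_fin; apply: le_trans (ler_norm _) _.
apply: le_trans (ler_normB _ _) _; apply: lerD; apply: hM; apply: Dn.
  by rewrite lexx ltW.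
by rewrite lexx ltW.
Qed.

(** The fundamental theorem of calculus on an open interval, by dominated
    convergence along an exhausting sequence of segments. *)
Lemma integral_derive (la lb : R) : mu.-integrable D (EFin \o h') ->
  h (a n) @[n --> \oo] --> la -> h (b n) @[n --> \oo] --> lb ->
  \int[mu]_(x in D) h' x = lb - la.
Proof.
move=> ih' hla hlb; rewrite /Rintegral.
have h1 : (\int[mu]_(x in D) f n x @[n --> \oo] -->
    \int[mu]_(x in D) (h' x)%:E)%E.
  apply: (@dominated_cvg _ _ _ mu D mD f _ (fun x => `|h' x|%:E)) => //.
  - exact: (integrable_norm ih').
  - move=> n x Dx; rewrite /f lee_fin normrM ler_piMr//.
    by rewrite indicE; case: (_ \in _); rewrite ?normr1 ?normr0.
have h2 : (\int[mu]_(x in D) f n x @[n --> \oo] --> (lb - la)%:E)%E.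
  under eq_cvg do rewrite int_f.
  by apply: cvg_EFin; [exact: nearW|exact: cvgB].
by rewrite -(cvg_lim _ h1)// (cvg_lim _ h2).
Qed.

End exhaustion.

(** The image of Lebesgue measure under dilation by [t] is Lebesgue measure
    divided by [t]: both agree on half-open intervals. *)
Lemma ge0_integral_scale (t : R) (f : R -> \bar R) : 0 < t ->
  measurable_fun setT f -> (forall x, 0 <= f x)%E ->
  (\int[mu]_x f x = t%:E * \int[mu]_x f (t * x)%R)%E.
Proof.
move=> t0 mf f0.
pose phi : measurableTypeR R -> measurableTypeR R := fun x : R => t * x.
have mt : measurable_fun setT phi by exact: measurable_funM.
have e := @ge0_integral_pushforward _ _ _ _ R phi mt mu setT f measurableT mf
  (fun x _ => f0 x).
rewrite preimage_setT in e; rewrite -[X in (t%:E * X)%E]e.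
pose tn : {nonneg R} := NngNum (ltW t0).
rewrite -(@ge0_integral_mscale _ _ R (pushforward mu phi) setT measurableT tn f)//.
apply: eq_measure_integral => A mA _ /=.
apply: lebesgue_measure_unique => //= _ [[p q]] _ <-.
rewrite /mscale/= /pushforward.
have -> : phi @^-1` `]p, q]%classic = `]p / t, q / t]%classic.
  apply/seteqP; split => x /=; rewrite !in_itv/=;
  by rewrite ltr_pdivrMr// ler_pdivlMr// (mulrC x).
rewrite !lebesgue_measure_itv/= !lte_fin ltr_pM2r ?invr_gt0//.
case: ifPn => _; last by rewrite mule0.
by rewrite -EFinB -EFinM -mulrBl mulrCA divff ?mulr1// gt_eqF.
Qed.

End improper.

(** * Mellin transforms *)

Section mellin.
Context {R : realType}.
Notation mu := (@lebesgue_measure R).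

(** The log-logistic density with scale 1 and shape [w], that is
    [w x^(w - 1) / (1 + x^w)^2], written with exponentials of [ln x]. It serves
    as a universal majorant: it decays polynomially at both ends, and has the
    explicit bounded primitive [- 1 / (1 + x^w)]. *)
Definition loglogistic (w x : R) : R :=
  w * expR ((w - 1) * ln x) * (1 + expR (w * ln x))^-1 ^+ 2.

Lemma loglogistic_ge0 (w x : R) : 0 <= w -> 0 <= loglogistic w x.
Proof. by move=> w0; rewrite !mulr_ge0 ?sqr_ge0 ?expR_ge0. Qed.

Lemma open_gt0 : open (`]0, +oo[ : set R).
Proof. exact: interval_open. Qed.

Lemma itv0y (x : R) : `]0, +oo[ x = (0 < x).
Proof. by rewrite /= in_itv/= andbT. Qed.

Lemma measurable_gt0 : measurable (`]0, +oo[ : set (measurableTypeR R)).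
Proof. exact: measurable_itv. Qed.

Lemma loglogistic_derive (w x : R) : 0 < x ->
  is_derive x 1 (fun y => - (1 + expR (w * ln y))^-1) (loglogistic w x).
Proof.
move=> x0.
have h1 : is_derive x 1 (fun y => w * ln y + 0) (w * x^-1).
  have := is_derive_add (is_derive_scale w (is_derive1_ln x0)) (is_derive_cst (0:R) x 1).
  by rewrite addr0.
have h2 : is_derive x 1 (fun y => 1 + expR (w * ln y))
    (0 + expR (w * ln x) * (w * x^-1)).
  have := is_derive_add (is_derive_cst (1:R) x 1) (is_derive_expR_comp h1).
  by rewrite addr0; under eq_fun do rewrite addr0.
have p0 : 1 + expR (w * ln x) != 0 by rewrite gt_eqF// ltr_wpDr ?expR_ge0.
have h3 := is_derive_scale (-1) (@is_derive_inv _ (fun y => 1 + expR (w * ln y)) _ _ p0 h2).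
have -> : (fun y => - (1 + expR (w * ln y))^-1) =
    (fun y => -1 * (1 + expR (w * ln y))^-1) :> (R -> R).
  by apply/funext => y; rewrite mulN1r.
apply: (is_derive_eq h3); rewrite add0r mulN1r mulNr opprK /loglogistic.
congr (_ * _); rewrite mulrBl mul1r expRD expRN lnK ?posrE//; ring.
Qed.

Lemma loglogistic_continuous (w x : R) : 0 < x ->
  {for x, continuous (loglogistic w)}.
Proof.
move=> x0; have cl : {for x, continuous (@ln R)} by exact: continuous_ln.
have ce (k : R) : {for x, continuous (fun y => expR (k * ln y))}.
  apply: (@continuous_comp _ _ _ (fun y : R => k * ln y) expR).
    by apply: continuousM => //; exact: cvg_cst.
  exact: continuous_expR.
have p0 : 1 + expR (w * ln x) != 0 by rewrite gt_eqF// ltr_wpDr ?expR_ge0.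
apply: continuousM.
  by apply: continuousM; [exact: cvg_cst|exact: ce].
apply: (@continuous_comp _ _ _ (fun y : R => (1 + expR (w * ln y))^-1) (fun y => y ^+ 2)).
  apply: continuousV => //; apply: continuousD; last exact: ce.
  exact: cvg_cst.
exact: exprn_continuous.
Qed.

Lemma loglogistic_integrable (w : R) : 0 < w ->
  mu.-integrable `]0, +oo[ (EFin \o loglogistic w).
Proof.
move=> w0.
apply: (@ge0_derive_integrable _ _ (fun n => n.+1%:R^-1) (fun n => n.+2%:R)
  (fun y => - (1 + expR (w * ln y))^-1) (loglogistic w) open_gt0 _ _ _ _ _ 1).
- move=> n; apply: (@le_lt_trans _ _ 1); last by rewrite ltr1n.
  by rewrite invf_le1// ler1n.
- move=> n x /=; rewrite !in_itv/= andbT => /andP[nx _].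
  by apply: lt_le_trans nx; rewrite invr_gt0.
- move=> x; rewrite itv0y => x0; near=> n; rewrite /= in_itv/=; apply/andP; split.
    rewrite invf_ple ?posrE//; apply: (@le_trans _ _ n%:R); last by rewrite ler_nat.
    by near: n; exact: nbhs_infty_ger.
  apply: (@le_trans _ _ n%:R); last by rewrite ler_nat; lia.
  by near: n; exact: nbhs_infty_ger.
- by move=> x; rewrite itv0y; exact: loglogistic_derive.
- by move=> x; rewrite itv0y; exact: loglogistic_continuous.
- by move=> x _; exact/loglogistic_ge0/ltW.
- move=> x _; rewrite normrN normfV ger0_norm ?addr_ge0 ?expR_ge0//.
  by rewrite invf_le1 ?ltr_wpDr ?expR_ge0// lerDl expR_ge0.
Unshelve. all: end_near. Qed.

Lemma expr_le_expR (w : R) (i : nat) : 0 < w ->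
  exists2 K, 0 <= K & forall y : R, `|y| ^+ i <= K * expR (w * `|y|).
Proof.
elim: i w => [|i ih] w w0.
  by exists 1 => // y; rewrite expr0 mul1r -expR0 ler_expR mulr_ge0// ltW.
have w20 : 0 < w / 2 by rewrite divr_gt0.
have [K K0 hK] := ih _ w20; exists ((w / 2)^-1 * K) => [|y].
  by rewrite mulr_ge0// invr_ge0 ltW.
rewrite exprS [w in expR (w * _)]splitr mulrDl expRD mulrACA.
apply: ler_pM => //; rewrite ler_pdivlMl//.
by apply: le_trans (expR_ge1Dx _); rewrite lerDr.
Qed.

(** The tangent inequality [1 + v <= e^v] at [v = y - ln (N / a)]. *)
Lemma linear_subr_expR_le (N a y : R) : 0 < N -> 0 < a ->
  N * y - a * expR y <= N * (ln (N / a) - 1).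
Proof.
move=> N0 a0; set c := ln (N / a).
have ac : a * expR c = N by rewrite lnK ?posrE ?divr_gt0// mulrCA divff ?mulr1 ?gt_eqF.
have -> : a * expR y = N * expR (y - c) by rewrite -ac -mulrA -expRD addrC subrK.
have := expR_ge1Dx (y - c); rewrite -(ler_pM2l N0); lra.
Qed.

(** [(ln x)^i * x^(z - 1) * e^(- a x)] for [x > 0]. The exponential form makes
    it differentiable in [z] for every real [x] and jointly measurable. *)
Definition mellin_kernel (a : R) (i : nat) (z x : R) : R :=
  ln x ^+ i * expR ((z - 1) * ln x - a * x).

(** With [y = ln x] and [w = z1 / 2] the claim is that
    [|y|^i e^((z - w) y - a e^y) (1 + e^(w y))^2] is bounded. The power of [|y|]
    is absorbed by [e^(w |y|)]; the rest is at most a constant for [y <= 0]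
    because [z >= 2 w], and for [y > 0] because [a e^y] outgrows any linear
    function of [y]. *)
Lemma mellin_kernel_dominated (a z1 z2 : R) (i : nat) : 0 < a -> 0 < z1 ->
  exists2 C, 0 <= C & forall z x, z1 <= z <= z2 -> 0 < x ->
    `|mellin_kernel a i z x| <= C * loglogistic (z1 / 2) x.
Proof.
move=> a0 z10; set w := z1 / 2.
have w0 : 0 < w by rewrite divr_gt0.
have [K K0 hK] := @expr_le_expR w i w0.
(* [N] bounds the coefficient of [y] in the exponent for [y > 0]: the part
   [z - w <= z2 - w], plus [w] from [|y|^i] and [2 w] from the square. *)
pose N := `|z2| + 2 * w; pose c := ln (N / a).
have N0 : 0 < N by rewrite ltr_wpDl// mulr_gt0.
exists (4 * K * (1 + expR (N * (c - 1))) / w).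
  by rewrite divr_ge0 ?mulr_ge0 ?addr_ge0 ?expR_ge0// ltW.
move=> z x /andP[z1z zz2] x0; rewrite /mellin_kernel normrM normrX.
rewrite [`|expR _|]ger0_norm ?expR_ge0//.
have xE : x = expR (ln x) by rewrite lnK// posrE.
rewrite [in a * x]xE /loglogistic; move: (ln x) => {x0 xE} y.
set E := expR (N * (c - 1)); set u := expR (w * y).
have E0 : 0 <= E by exact: expR_ge0.
have u0 : 0 <= u by exact: expR_ge0.
have w2 : z1 = 2 * w by rewrite /w; field.
have B : expR (w * `|y|) * expR ((z - w) * y - a * expR y) * (1 + u) ^+ 2
    <= 4 * (1 + E).
  rewrite -expRD; have [y0|y0] := leP y 0.
    have h1 : expR (w * `|y| + ((z - w) * y - a * expR y)) <= 1.
      rewrite -expR0 ler_expR ler0_norm//.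
      have : 0 <= a * expR y by rewrite mulr_ge0 ?expR_ge0// ltW.
      have : (z - z1) * y <= 0 by rewrite mulr_ge0_le0// subr_ge0.
      by rewrite w2; lra.
    have h2 : (1 + u) ^+ 2 <= 4.
      have u1 : u <= 1 by rewrite -expR0 ler_expR mulr_ge0_le0// ltW.
      by nra.
    by apply: (@le_trans _ _ (1 * 4)); [exact: ler_pM (expR_ge0 _) (sqr_ge0 _) h1 h2|lra].
  have h2 : (1 + u) ^+ 2 <= 4 * expR (2 * w * y).
    have -> : 2 * w * y = w * y + w * y by ring.
    rewrite expRD -/u; have u1 : 1 <= u by rewrite -expR0 ler_expR mulr_ge0// ltW.
    by nra.
  apply: le_trans (ler_wpM2l (expR_ge0 _) h2) _.
  rewrite mulrCA -expRD ler_pM2l//; apply: (@le_trans _ _ E); last by rewrite lerDr.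
  rewrite ler_expR ger0_norm; last exact: ltW.
  have h3 := @linear_subr_expR_le N a y N0 a0.
  have h4 : z * y <= `|z2| * y.
    by rewrite ler_pM2r// (le_trans zz2)// ler_norm.
  by move: h3; rewrite -/c {1}/N; lra.
have v0 : 0 < (1 + u)^-1 ^+ 2 by rewrite exprn_gt0// invr_gt0 ltr_wpDr.
have vE : (1 + u) ^+ 2 * (1 + u)^-1 ^+ 2 = 1.
  by rewrite -exprMn divff ?expr1n// gt_eqF// ltr_wpDr.
have -> : (z - 1) * y - a * expR y =
  (w - 1) * y + ((z - w) * y - a * expR y) by ring.
rewrite expRD; set e1 := expR ((w - 1) * y); set e2 := expR (_ - _) in B *.
have -> : 4 * K * (1 + E) / w * (w * e1 * (1 + u)^-1 ^+ 2) =
  (4 * (1 + E)) * (K * e1 * (1 + u)^-1 ^+ 2).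
  by field; rewrite !gt_eqF// ltr_wpDr.
have k0 : 0 <= K * e1 * (1 + u)^-1 ^+ 2.
  by apply: mulr_ge0; [exact: mulr_ge0 K0 (expR_ge0 _)|exact: ltW].
apply: le_trans (ler_wpM2r k0 B).
have -> : expR (w * `|y|) * e2 * (1 + u) ^+ 2 * (K * e1 * (1 + u)^-1 ^+ 2) =
  (K * expR (w * `|y|)) * (e1 * e2) * ((1 + u) ^+ 2 * (1 + u)^-1 ^+ 2) by ring.
rewrite vE mulr1; apply: ler_wpM2r; last exact: hK.
by rewrite mulr_ge0 ?expR_ge0.
Qed.


Lemma measurable_mellin_kernel (a : R) i (z : R) : measurable_fun setT (mellin_kernel a i z).
Proof.
apply: measurable_funM; first by apply: measurable_funX; exact: measurable_ln.
apply: measurableT_comp; first exact: measurable_expR.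
by apply: measurable_funB; apply: measurable_funM => //; exact: measurable_ln.
Qed.

Lemma is_derive_mellin_kernel (a : R) i (z x : R) :
  is_derive z 1 (fun z : R => mellin_kernel a i z x) (mellin_kernel a i.+1 z x).
Proof.
have h1 := is_derive_expR_comp (is_derive_affine (ln x) (- ln x - a * x) z).
have h2 := is_derive_scale (ln x ^+ i) h1.
have -> : (fun z => mellin_kernel a i z x) =
    (fun y => ln x ^+ i * expR (ln x * y + (- ln x - a * x))) :> (R -> R).
  by apply/funext => y; rewrite /mellin_kernel; congr (_ * expR _); ring.
apply: (is_derive_eq h2); rewrite /mellin_kernel exprSr.
by rewrite mulrCA mulrC; congr (_ * expR _); ring.
Qed.

Lemma integrable_scale (D : set (measurableTypeR R)) (k : R) (f : R -> R) : measurable D ->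
  mu.-integrable D (EFin \o f) -> mu.-integrable D (EFin \o (fun x => k * f x)).
Proof.
move=> mD hf; have := @integrableZl _ _ _ mu D mD k _ hf.
by congr (mu.-integrable _ _); apply/funext => x; rewrite /= EFinM.
Qed.

Lemma is_derive_Rintegral (D : set (measurableTypeR R)) (f f' : R -> R -> R)
    (G : R -> R) (c u v : R) :
  measurable D -> `]u, v[ c ->
  (forall t, `]u, v[ t -> mu.-integrable D (EFin \o f t)) ->
  (forall t x, `]u, v[ t -> D x -> is_derive t 1 (f ^~ x) (f' t x)) ->
  mu.-integrable D (EFin \o G) ->
  (forall t x, `]u, v[ t -> D x -> `|f' t x| <= G x) ->
  is_derive c 1 (fun t => \int[mu]_(x in D) f t x) (\int[mu]_(x in D) f' c x).
Proof.
move=> mD Ic intf df iG Gub.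
have derf t x : `]u, v[ t -> D x -> derivable (f ^~ x) t 1.
  by move=> It Dx; exact: (derivable_is_derive (df _ _ It Dx)).
have d1f t x : `]u, v[ t -> D x -> partial1of2 f t x = f' t x.
  by move=> It Dx; exact: (derive1_is_derive (df _ _ It Dx)).
pose N (x : measurableTypeR R) : R := `|G x|.
have N0 x : 0 <= N x by exact: normr_ge0.
have iN : mu.-integrable D (EFin \o N).
  rewrite (_ : EFin \o N = (fun x => `|(G x)%:E|%E))//.
  exact: integrable_norm.
have Nub t x : `]u, v[ t -> D x -> `|partial1of2 f t x| <= N x.
  by move=> It Dx; rewrite d1f// (le_trans (Gub _ _ It Dx))// ler_norm.
have h1 := @derivable_under_integral R _ (measurableTypeR R) mu f D mD c u v
  Ic intf derf N N0 iN Nub.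
have h2 := @differentiation_under_integral R _ (measurableTypeR R) mu f D mD c u v
  Ic intf derf N N0 iN Nub.
apply: (is_derive_eq (is_derive_derive1 h1)); rewrite h2.
by apply: eq_Rintegral => x /[!inE] Dx; rewrite d1f.
Qed.

Section transform.
Variables (a : R) (q : R -> R) (Cq : R).
Hypothesis a0 : 0 < a.
Hypothesis mq : measurable_fun (`]0, +oo[ : set R) q.
Hypothesis qC : forall x, 0 < x -> `|q x| <= Cq.

Definition mellin (i : nat) (z : R) : R :=
  \int[mu]_(x in `]0, +oo[) (q x * mellin_kernel a i z x).

Let Cq0 : 0 <= Cq.
Proof. exact: le_trans (qC ltr01). Qed.

Lemma measurable_mellin_integrand i z :
  measurable_fun (`]0, +oo[ : set R) (fun x => q x * mellin_kernel a i z x).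
Proof.
by apply: measurable_funM => //; apply: measurable_funTS; exact: measurable_mellin_kernel.
Qed.

Lemma mellin_integrable i z : 0 < z ->
  mu.-integrable `]0, +oo[ (EFin \o (fun x => q x * mellin_kernel a i z x)).
Proof.
move=> z0; have [C C0 hC] := @mellin_kernel_dominated a z z i a0 z0.
apply: (@le_integrable _ _ _ mu _ measurable_gt0 _
  (fun x => (Cq * C * loglogistic (z / 2) x)%:E)).
- by apply/measurable_EFinP; exact: measurable_mellin_integrand.
- move=> x; rewrite itv0y => x0; rewrite lee_fin normrM.
  rewrite [leRHS]ger0_norm; last first.
    apply: mulr_ge0; first exact: mulr_ge0.
    by apply: loglogistic_ge0; rewrite divr_ge0// ltW.
  rewrite -mulrA; apply: ler_pM => //; first exact: qC.
  by apply: hC; rewrite ?lexx.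
- apply: (integrable_scale _ measurable_gt0).
  by apply: loglogistic_integrable; rewrite divr_gt0.
Qed.

(** Deriving in [z] multiplies the integrand by [ln x]; the majorant for the
    exponent [z / 2] dominates the derivative for all exponents near [z]. *)
Lemma is_derive_mellin i (z : R) : 0 < z -> is_derive z 1 (mellin i) (mellin i.+1 z).
Proof.
move=> z0; pose I : set R := `]z / 2, z + 1[.
have z20 : 0 < z / 2 by rewrite divr_gt0.
have I_gt0 t : I t -> 0 < t.
  by rewrite /I /= in_itv/= => /andP[+ _]; exact: lt_trans.
have Iz : I z by rewrite /I/= in_itv/=; apply/andP; split; lra.
have [C C0 hC] := @mellin_kernel_dominated a (z / 2) (z + 1) i.+1 a0 z20.
apply: (@is_derive_Rintegral _ (fun t x => q x * mellin_kernel a i t x)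
  (fun t x => q x * mellin_kernel a i.+1 t x)
  (fun x => Cq * C * loglogistic (z / 2 / 2) x) _ _ _ measurable_gt0 Iz).
- by move=> t /I_gt0; exact: mellin_integrable.
- by move=> t x _ _; exact: (is_derive_scale (q x) (is_derive_mellin_kernel a i t x)).
- apply: (integrable_scale _ measurable_gt0).
  by apply: loglogistic_integrable; rewrite divr_gt0.
- move=> t x; rewrite itv0y /= in_itv/= => /andP[t1 t2] x0; rewrite normrM -mulrA.
  by apply: ler_pM => //; [exact: qC|apply: hC => //; rewrite !ltW].
Qed.

Lemma smooth_mellin i : smooth 0 (mellin i).
Proof.
move=> n; elim: n i => [|n ih] i; first by move=> ? ?; rewrite ltn0.
exact: (smoothnS_derive (@is_derive_mellin i) (ih i.+1)).
Qed.

End transform.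

End mellin.

(** * The Gamma function *)

Section Gamma_function.
Context {R : realType}.
Notation mu := (@lebesgue_measure R).

Lemma GammaE (z : R) : Gamma z = mellin 1 (fun=> 1) 0 z.
Proof.
apply: eq_Rintegral => x /[!inE]; rewrite itv0y => x0.
by rewrite /mellin_kernel expr0 !mul1r expRD /powR gt_eqF.
Qed.

Lemma norm_one_le (x : R) : 0 < x -> `|1 : R| <= 1.
Proof. by rewrite normr1. Qed.

Lemma measurable_one : measurable_fun (`]0, +oo[ : set R) (fun=> 1 : R).
Proof. exact: measurable_cst. Qed.

Lemma smooth_Gamma : smooth 0 (@Gamma R).
Proof.
have h := @smooth_mellin R 1 (fun=> 1) 1 ltr01 measurable_one norm_one_le 0%N.
by apply: (eq_smooth _ h) => z _; rewrite GammaE.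
Qed.

Lemma Gamma_integrable (z : R) : 0 < z ->
  mu.-integrable `]0, +oo[ (EFin \o mellin_kernel 1 0 z).
Proof.
move=> z0; have := mellin_integrable (@ltr01 R) measurable_one norm_one_le 0 z0.
by congr (mu.-integrable _ _); apply/funext => x /=; rewrite mul1r.
Qed.

Lemma Gamma_gt0 (z : R) : 0 < z -> 0 < Gamma z.
Proof.
move=> z0; have i1 := Gamma_integrable z0.
have s12 : `[1, 2] `<=` (`]0, +oo[ : set R).
  by move=> x /=; rewrite !in_itv/= andbT => /andP[+ _]; exact: lt_le_trans.
have i2 : mu.-integrable `[1, 2] (EFin \o mellin_kernel 1 0 z).
  by apply: (@integrableS _ _ _ mu _ _ _ measurable_gt0 _ s12 i1); exact: measurable_itv.
pose m := expR (- `|z - 1| * ln 2 - 2).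
have ic : mu.-integrable `[1, 2] (EFin \o (fun=> m)).
  apply: continuous_compact_integrable; first exact: segment_compact.
  by apply: continuous_subspaceT => x; exact: cvg_cst.
have h1 : \int[mu]_(x in `[1, 2]) m <= \int[mu]_(x in `[1, 2]) mellin_kernel 1 0 z x.
  apply: le_Rintegral => // x /=; rewrite in_itv/= => /andP[x1 x2].
  rewrite /mellin_kernel expr0 mul1r mul1r /m ler_expR lerD ?lerN2//.
  have l0 : 0 <= ln x by exact: ln_ge0.
  have l2 : ln x <= ln 2 by rewrite ler_ln ?posrE// (lt_le_trans ltr01).
  have h2 : - (z - 1) <= `|z - 1| by rewrite -normrN ler_norm.
  have h3 : - (z - 1) * ln x <= `|z - 1| * ln x by rewrite ler_wpM2r.
  have h4 : `|z - 1| * ln x <= `|z - 1| * ln 2 by rewrite ler_wpM2l.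
  by lra.
have h2 : \int[mu]_(x in `[1, 2]) mellin_kernel 1 0 z x <= Gamma z.
  rewrite GammaE /mellin; under [leRHS]eq_Rintegral do rewrite mul1r.
  rewrite /Rintegral; apply: fine_le.
  - by apply: integrable_fin_num => //; exact: measurable_itv.
  - by apply: integrable_fin_num => //; exact: measurable_itv.
  - apply: ge0_subset_integral => //.
      by apply/measurable_EFinP/measurable_funTS; exact: measurable_mellin_kernel.
    by move=> x _; rewrite lee_fin /mellin_kernel expr0 mul1r expR_ge0.
apply: lt_le_trans h2; apply: lt_le_trans h1.
have e12 : mu `[1, 2]%classic = 1%:E.
  by rewrite lebesgue_measure_itv/= lte_fin ltr1n/= -EFinB; congr (_%:E); ring.
have -> : \int[mu]_(x in `[1, 2]) m = m * fine (mu `[1, 2]%classic).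
  exact: Rintegral_cst.
by rewrite e12 mulr1 expR_gt0.
Qed.

(** Integration by parts: the derivative of [x^z e^(- x)] integrates to 0 over
    the positive half-line. *)
Lemma GammaS (z : R) : 0 < z -> Gamma (z + 1) = z * Gamma z.
Proof.
move=> z0; have z10 : 0 < z + 1 by rewrite ltr_wpDr.
pose h x := expR (z * ln x - x).
pose h' x := z * mellin_kernel 1 0 z x - mellin_kernel 1 0 (z + 1) x.
(* End points for which the boundary terms are bounded by geometric
   sequences. *)
pose a (n : nat) := expR (- n.+1%:R) : R; pose b (n : nat) := expR n.+1%:R : R.
have ab n : a n < b n by rewrite ltr_expR gtrN.
have abD n : `[a n, b n] `<=` (`]0, +oo[ : set R).
  move=> x /=; rewrite !in_itv/= andbT => /andP[+ _]; apply: lt_le_trans.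
  exact: expR_gt0.
have exD x : (`]0, +oo[ : set R) x -> \forall n \near \oo, `[a n, b n] x.
  rewrite itv0y => x0.
  have : \forall n \near \oo, `|ln x| <= n%:R by exact: nbhs_infty_ger.
  apply: filterS => n; rewrite ler_norml => /andP[l1 l2].
  rewrite /= in_itv/= -[x in _ <= x <= _]lnK ?posrE// !ler_expR; apply/andP.
  have n1 : n%:R <= n.+1%:R :> R by rewrite ler_nat.
  by split; [apply: le_trans l1; rewrite lerN2|exact: le_trans n1].
have dh x : (`]0, +oo[ : set R) x -> is_derive x 1 h (h' x).
  rewrite itv0y => x0.
  have h1 : is_derive x 1 (fun y => z * ln y - y) (z * x^-1 - 1).
    have := is_derive_add (is_derive_scale z (is_derive1_ln x0))
      (is_derive_scale (-1) (is_derive_id x 1)).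
    by rewrite mulr1; under eq_fun do rewrite mulN1r.
  apply: (is_derive_eq (is_derive_expR_comp h1)).
  rewrite /h' /mellin_kernel !expr0 !mul1r addrK mulrBr mulr1; congr (_ - _).
  rewrite mulrCA; congr (_ * _).
  have -> : (z - 1) * ln x - x = z * ln x - x - ln x by ring.
  by rewrite [RHS]expRD expRN lnK// posrE.
have ck (w x : R) : 0 < x -> {for x, continuous (mellin_kernel 1 0 w)}.
  move=> x0; have -> : mellin_kernel 1 0 w = (fun y => expR ((w - 1) * ln y - y)) :> (R -> R).
    by apply/funext => y; rewrite /mellin_kernel expr0 !mul1r.
  apply: (@continuous_comp _ _ _ (fun y : R => (w - 1) * ln y - y) expR).
    apply: continuousB; last exact: cvg_id.
    by apply: continuousM; [exact: cvg_cst|exact: continuous_ln].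
  exact: continuous_expR.
have ch' x : (`]0, +oo[ : set R) x -> {for x, continuous h'}.
  rewrite itv0y => x0; apply: continuousB; last exact: ck.
  by apply: continuousM; [exact: cvg_cst|exact: ck].
have i1 := integrable_scale z measurable_gt0 (Gamma_integrable z0).
have i2 := Gamma_integrable z10.
have ih' : mu.-integrable `]0, +oo[ (EFin \o h').
  have := integrableB measurable_gt0 i1 i2.
  by congr (mu.-integrable _ _); apply/funext => x /=; rewrite EFinB.
have geo : expR (- z) ^+ n.+1 @[n --> \oo] --> (0 : R).
  rewrite cvg_shiftS; apply: cvg_expr.
  by rewrite ger0_norm ?expR_ge0// -expR0 ltr_expR oppr_lt0.
have geo1 : expR (- 1) ^+ n.+1 @[n --> \oo] --> (0 : R).
  rewrite cvg_shiftS; apply: cvg_expr.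
  by rewrite ger0_norm ?expR_ge0// -expR0 ltr_expR oppr_lt0.
have ha : h (a n) @[n --> \oo] --> (0 : R).
  apply: (@squeeze_cvgr _ _ _ _ (fun=> 0) (fun n => expR (- z) ^+ n.+1)) => //;
    last exact: cvg_cst.
  apply: nearW => n; rewrite expR_ge0/= -expRM_natl ler_expR /a expRK.
  by rewrite mulrN mulrC mulrN lerBlDr lerDl expR_ge0.
have hb : h (b n) @[n --> \oo] --> (0 : R).
  pose K := expR ((z + 1) * (ln (z + 1) - 1)).
  apply: (@squeeze_cvgr _ _ _ _ (fun=> 0) (fun n => K * expR (- 1) ^+ n.+1)) => //.
  - apply: nearW => n; rewrite expR_ge0/= -expRM_natl /K -expRD ler_expR /b expRK.
    have := @linear_subr_expR_le _ (z + 1) 1 n.+1%:R z10 ltr01.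
    by rewrite divr1; lra.
  - exact: cvg_cst.
  - by rewrite -[X in _ --> X](mulr0 K); apply: cvgM => //; exact: cvg_cst.
have := integral_derive open_gt0 ab abD exD dh ch' ih' ha hb.
have -> : \int[mu]_(x in `]0, +oo[) h' x = z * Gamma z - Gamma (z + 1).
  have gE w : Gamma w = \int[mu]_(x in `]0, +oo[) mellin_kernel 1 0 w x.
    by rewrite GammaE; apply: eq_Rintegral => x _; rewrite mul1r.
  rewrite !gE -RintegralZl; [|exact: measurable_gt0|exact: Gamma_integrable].
  by rewrite -RintegralB//; exact: measurable_gt0.
by rewrite subr0 => /eqP; rewrite subr_eq0 => /eqP <-.
Qed.

End Gamma_function.

(** * Families of kernels closed under derivation in time *)

Section families.
Context {R : realType}.
Notation mu := (@lebesgue_measure R).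
Variables (a b e u : R) (q : R -> R) (Cq : R).
Hypothesis a0 : 0 < a.
Hypothesis mq : measurable_fun (`]0, +oo[ : set R) q.
Hypothesis qC : forall x, 0 < x -> `|q x| <= Cq.
Hypothesis u0 : forall s, u < s -> 0 < b * s + e.

(** [family phi Phi] says that [phi x s] is a finite sum of terms
    [c s * (ln x)^i * x^(b s + e - 1) * e^(- a x)] with smooth coefficients, and
    that [Phi s] is the integral of [phi x s] against the weight [q x]. Both are
    built in parallel so that every identity for [phi] transfers to [Phi]. *)
Inductive family : (R -> R -> R) -> (R -> R) -> Prop :=
| family_term c i : smooth u c ->
    family (fun x s => c s * mellin_kernel a i (b * s + e) x)
           (fun s => c s * mellin a q i (b * s + e))
| family_add phi Phi psi Psi : family phi Phi -> family psi Psi ->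
    family (fun x s => phi x s + psi x s) (fun s => Phi s + Psi s).

Lemma family_mul c phi Phi : smooth u c -> family phi Phi ->
  family (fun x s => c s * phi x s) (fun s => c s * Phi s).
Proof.
move=> sc; elim=> [c' i sc'|phi1 Phi1 phi2 Phi2 _ h1 _ h2].
- have := family_term i (smoothM sc sc').
  by congr family; [do 2 apply/funext => ?|apply/funext => ?]; rewrite mulrA.
- have := family_add h1 h2.
  by congr family; [do 2 apply/funext => ?|apply/funext => ?]; rewrite mulrDr.
Qed.

(** Deriving a term in time gives two terms of the same shape, one with the
    derivative of the coefficient and one with an extra factor [b * ln x]. *)
Lemma family_derive phi Phi : family phi Phi ->
  exists phi' Phi', [/\ family phi' Phi',
    forall x s, u < s -> is_derive s 1 (phi x) (phi' x s) &
    forall s, u < s -> is_derive s 1 Phi (Phi' s)].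
Proof.
elim=> [c i sc|phi1 Phi1 phi2 Phi2 _ [p1 [P1 [f1 d1 D1]]] _ [p2 [P2 [f2 d2 D2]]]].
- have sbc := @smoothZ _ u b c sc; have sc' := smooth_derive1 sc.
  eexists; eexists; split.
    exact: (family_add (family_term i sc') (family_term i.+1 sbc)).
  + move=> x s us /=.
    have h := is_derive_mul (smooth_is_derive sc us)
      (is_derive_comp_affine (is_derive_mellin_kernel a i (b * s + e) x)).
    by apply: (is_derive_eq h); ring.
  + move=> s us /=.
    have h := is_derive_mul (smooth_is_derive sc us)
      (is_derive_comp_affine (is_derive_mellin a0 mq qC i (u0 us))).
    by apply: (is_derive_eq h); ring.
- eexists; eexists; split; first exact: (family_add f1 f2).
  + by move=> x s us; exact: (is_derive_add (d1 x s us) (d2 x s us)).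
  + by move=> s us; exact: (is_derive_add (D1 s us) (D2 s us)).
Qed.

Lemma family_smooth phi Phi : family phi Phi ->
  (forall x, smooth u (phi x)) /\ smooth u Phi.
Proof.
move=> f; suff h n : (forall x, smoothn u n (phi x)) /\ smoothn u n Phi.
  by split=> [x n|n]; have [] := h n.
elim: n phi Phi f => [|n ih] phi Phi f; first by split=> [x|] t i; rewrite ltn0.
have [phi' [Phi' [f' d' D']]] := family_derive f; have [h1 h2] := ih _ _ f'.
by split=> [x|]; [exact: (smoothnS_derive (d' x) (h1 x))|exact: (smoothnS_derive D' h2)].
Qed.

Lemma family_derive1n n phi Phi : family phi Phi ->
  exists phi' Phi', [/\ family phi' Phi',
    forall x s, u < s -> derive1n n (phi x) s = phi' x s &
    forall s, u < s -> derive1n n Phi s = Phi' s].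
Proof.
move=> f; elim: n => [|n [p [P [f1 d1 D1]]]]; first by exists phi, Phi.
have [p' [P' [f2 d2 D2]]] := family_derive f1; exists p', P'; split=> //.
- move=> x s us; rewrite derive1nS (eq_derive1_gt (d1 x) us).
  exact: (derive1_is_derive (d2 x s us)).
- move=> s us; rewrite derive1nS (eq_derive1_gt D1 us).
  exact: (derive1_is_derive (D2 s us)).
Qed.

Lemma family_integral phi Phi : family phi Phi -> forall s, u < s ->
  mu.-integrable `]0, +oo[ (EFin \o (fun x => q x * phi x s)) /\
  \int[mu]_(x in `]0, +oo[) (q x * phi x s) = Phi s.
Proof.
elim=> [c i sc|phi1 Phi1 phi2 Phi2 _ h1 _ h2] s us.
- have h := mellin_integrable a0 mq qC i (u0 us).
  have h' := integrable_scale (c s) measurable_gt0 h.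
  have -> : (fun x => q x * (c s * mellin_kernel a i (b * s + e) x)) =
      (fun x => c s * (q x * mellin_kernel a i (b * s + e) x)).
    by apply/funext => x; rewrite mulrCA.
  by split => //; rewrite RintegralZl//; exact: measurable_itv.
- have [i1 e1] := h1 s us; have [i2 e2] := h2 s us.
  have -> : (fun x => q x * (phi1 x s + phi2 x s)) =
      (fun x => q x * phi1 x s + q x * phi2 x s).
    by apply/funext => x; rewrite mulrDr.
  split; last by rewrite RintegralD ?e1 ?e2//; exact: measurable_itv.
  have := integrableD measurable_gt0 i1 i2.
  by congr (mu.-integrable _ _); apply/funext => x /=; rewrite EFinD.
Qed.

End families.

(** * Riemann-Liouville integrals of smooth functions *)

Section fractional.
Context {R : realType}.
Notation mu := (@lebesgue_measure R).

Lemma itv0tE (t s : R) : `]0, t[ s = (0 < s < t).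
Proof. by rewrite /= in_itv. Qed.

(** The substitution [s = t v], from the nonnegative case applied to the
    positive and negative parts. *)
Lemma integrable_scaled (t : R) (k : R -> R) : 0 < t ->
  mu.-integrable `]0, t[ (EFin \o k) ->
  mu.-integrable `]0, 1[ (EFin \o (fun v => k (t * v))) /\
  \int[mu]_(s in `]0, t[) k s = t * \int[mu]_(v in `]0, 1[) k (t * v).
Proof.
move=> t0 ik.
pose D : set (measurableTypeR R) := `]0, t[.
pose E : set (measurableTypeR R) := `]0, 1[.
have mD : measurable D by exact: measurable_itv.
have mE : measurable E by exact: measurable_itv.
pose g := (EFin \o k) \_ D.
have ig : mu.-integrable setT g by apply/integrable_restrict => //; rewrite setTI.
have mg : measurable_fun setT g by exact: (measurable_int mu ig).
have gE : (fun v => g (t * v)) = (EFin \o (fun v => k (t * v))) \_ E.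
  apply/funext => v; rewrite /g !patchE; congr (if _ then _ else _).
  apply/idP/idP; rewrite !inE /D /E !itv0tE => /andP[v0 v1]; apply/andP.
    by rewrite pmulr_rgt0// in v0; rewrite gtr_pMr// in v1.
  by rewrite pmulr_rgt0// gtr_pMr.
have mt : measurable_fun setT (fun x : measurableTypeR R => t * x : measurableTypeR R).
  exact: measurable_funM.
have mgt : measurable_fun setT (fun v => g (t * v)) by exact: measurableT_comp mg mt.
have igt : mu.-integrable setT (fun v => g (t * v)).
  apply/integrableP; split => //.
  have /integrableP[_] := ig.
  rewrite (@ge0_integral_scale _ t (fun x => `|g x|%E))//; last exact: measurableT_comp.
  move=> h; rewrite ltey; apply/eqP => h'; move: h.
  by rewrite h' gt0_muley ?lte_fin.
split.
  by move: igt; rewrite gE => /integrable_restrict; rewrite setTI; apply.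
have e1 : (\int[mu]_(x in D) (k x)%:E = \int[mu]_x g x)%E by rewrite integral_mkcond.
have e2 : (\int[mu]_(v in E) (k (t * v))%:E = \int[mu]_v g (t * v)%R)%E.
  by rewrite gE -integral_mkcond.
pose gt v := g (t * v).
have fP := integrable_fin_num measurableT (integrable_funepos measurableT igt).
have e4 : (\int[mu]_v gt v = \int[mu]_v gt^\+ v - \int[mu]_v gt^\- v)%E.
  by rewrite [LHS]integralE.
have e5 : (\int[mu]_v g^\+ v = t%:E * \int[mu]_v gt^\+ v)%E.
  have h := ge0_integral_scale t0 (measurable_funepos mg) (funepos_ge0 g).
  by rewrite [LHS]h; congr (_ * _)%E; apply: eq_integral => v _; rewrite funepos_comp.
have e6 : (\int[mu]_v g^\- v = t%:E * \int[mu]_v gt^\- v)%E.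
  have h := ge0_integral_scale t0 (measurable_funeneg mg) (funeneg_ge0 g).
  by rewrite [LHS]h; congr (_ * _)%E; apply: eq_integral => v _; rewrite funeneg_comp.
have e3 : (\int[mu]_x g x = t%:E * \int[mu]_v gt v)%E.
  rewrite e4 [LHS]integralE e5 e6 [RHS]muleBr//.
  exact: fin_num_adde_defr.
rewrite /Rintegral e1 e2 e3 fineM//.
by have := integrable_fin_num measurableT igt.
Qed.

(** The Riemann-Liouville integral of order [1 - alpha] from 0, without its
    normalisation [1 / Gamma (1 - alpha)]. *)
Definition fracI (alpha : R) (f : R -> R) (t : R) : R :=
  \int[mu]_(s in `]0, t[) (f s / (t - s) `^ alpha).

Implicit Types (f g : R -> R) (t s r : R).

Variable alpha : R.
Hypothesis alpha01 : 0 < alpha < 1.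

Let al0 : 0 < 1 - alpha. Proof. by have /andP[] := alpha01; lra. Qed.

Lemma is_derive_powR_sub (t s r : R) : s < t ->
  is_derive s 1 (fun y => (t - y) `^ r) (- (r * (t - s) `^ (r - 1))).
Proof.
move=> st; have st0 : 0 < - 1 * s + t by lra.
have h := is_derive_comp_affine (is_derive1_powR r st0).
have -> : (fun y => (t - y) `^ r) = (fun y => (-1 * y + t) `^ r) :> (R -> R).
  by apply/funext => y; rewrite mulN1r addrC.
by apply: (is_derive_eq h); rewrite mulN1r addrC mulN1r.
Qed.

Lemma continuous_powR_sub (t s r : R) : s < t ->
  {for s, continuous (fun y => (t - y) `^ r)}.
Proof. by move=> /(is_derive_powR_sub r)/is_derive_continuous. Qed.

Section exhaust.
Variable t : R.
Hypothesis t0 : 0 < t.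

(* The distance to both ends is geometric, so that its powers still tend to 0
   as geometric sequences. *)
Let a (n : nat) := t * expR (- n.+1%:R).
Let b (n : nat) := t - t * expR (- n.+1%:R).

Lemma exhaust_lt n : a n < b n.
Proof.
rewrite /a /b; suff : expR (- n.+1%:R) < 2^-1 :> R.
  by rewrite -(ltr_pM2l t0); lra.
apply: (@le_lt_trans _ _ (expR (- 1))).
  by rewrite ler_expR lerN2 ler1n.
by rewrite expRN ltf_pV2 ?posrE ?expR_gt0//; have := @expR_gt1Dx R 1 (oner_neq0 _).
Qed.

Lemma exhaust_pos n : 0 < a n < t.
Proof.
by rewrite /a mulr_gt0 ?expR_gt0//= gtr_pMr// -expR0 ltr_expR oppr_lt0 ltr0n.
Qed.

Lemma exhaust_sub n : `[a n, b n] `<=` `]0, t[.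
Proof.
move=> x; rewrite itv0tE /= in_itv/= => /andP[ax xb].
have /andP[a_gt0 _] := exhaust_pos n.
rewrite (lt_le_trans a_gt0 ax)/= (le_lt_trans xb)// /b.
by move: a_gt0; rewrite /a; lra.
Qed.

Lemma exhaust_geometric : expR (- n.+1%:R) @[n --> \oo] --> (0 : R).
Proof.
have -> : (fun n => expR (- n.+1%:R)) = (fun n => expR (- 1) ^+ n.+1) :> (nat -> R).
  by apply/funext => n; rewrite -expRM_natl mulrN1.
rewrite (cvg_shiftS (fun n => expR (- 1) ^+ n)); apply: cvg_expr.
by rewrite ger0_norm ?expR_ge0// -expR0 ltr_expR oppr_lt0.
Qed.

Lemma exhaust_a : a n @[n --> \oo] --> (0 : R).
Proof.
rewrite -[X in _ --> X](mulr0 t).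
by apply: cvgM; [exact: cvg_cst|exact: exhaust_geometric].
Qed.

Lemma exhaust_cover x : `]0, t[ x -> \forall n \near \oo, `[a n, b n] x.
Proof.
rewrite itv0tE => /andP[x0 xt].
have tx0 : 0 < t - x by rewrite subr_gt0.
have h1 : \forall n \near \oo, a n < x by exact: (cvgr_lt _ exhaust_a _ x0).
have h2 : \forall n \near \oo, a n < t - x by exact: (cvgr_lt _ exhaust_a _ tx0).
near=> n; rewrite /= in_itv/=; apply/andP; split.
  by apply: ltW; near: n.
have : a n < t - x by near: n.
by rewrite /b -/(a n); lra.
Unshelve. all: end_near. Qed.

Lemma open_0t : open (`]0, t[ : set R). Proof. exact: interval_open. Qed.

Lemma measurable_0t : measurable (`]0, t[ : set (measurableTypeR R)).
Proof. exact: measurable_itv. Qed.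

(** The primitive [- (t - s)^(1 - alpha) / (1 - alpha)] stays bounded up to the
    singularity since [alpha < 1]. *)
Lemma powR_kernel_integrable :
  mu.-integrable `]0, t[ (EFin \o (fun s => ((t - s) `^ alpha)^-1)).
Proof.
pose h (s : R) : R := - ((1 - alpha)^-1 * (t - s) `^ (1 - alpha)).
have -> : (fun s => ((t - s) `^ alpha)^-1) = (fun s => (t - s) `^ (- alpha)).
  by apply/funext => s; rewrite powRN.
apply: (@ge0_derive_integrable _ _ a b h _ open_0t exhaust_lt exhaust_sub exhaust_cover
  _ _ ((1 - alpha)^-1 * t `^ (1 - alpha))).
- move=> s; rewrite itv0tE => /andP[_ st].
  have := is_derive_scale (- (1 - alpha)^-1) (is_derive_powR_sub (1 - alpha) st).
  have -> : (fun y => - (1 - alpha)^-1 * (t - y) `^ (1 - alpha)) = h.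
    by apply/funext => y; rewrite /h mulNr.
  move=> hd; apply: (is_derive_eq hd).
  by rewrite mulrNN mulrA mulVf ?gt_eqF// mul1r; congr (_ `^ _); ring.
- by move=> s; rewrite itv0tE => /andP[_ st]; exact: continuous_powR_sub.
- by move=> s _; exact: powR_ge0.
- move=> s; rewrite itv0tE => /andP[s0 st].
  have al1 := ltW al0.
  rewrite /h normrN ger0_norm; last by rewrite mulr_ge0 ?powR_ge0 ?invr_ge0.
  rewrite ler_pM2l ?invr_gt0//; apply: ge0_ler_powR => //; rewrite ?nnegrE; lra.
Qed.

Lemma kernel_continuous u f s : smooth u f -> u < 0 -> 0 < s < t ->
  {for s, continuous (fun s => f s / (t - s) `^ alpha)}.
Proof.
move=> sf u0 /andP[s0 st]; apply: continuousM.
  exact: smooth_continuous sf (lt_trans u0 s0).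
apply: continuousV; last exact: continuous_powR_sub.
by rewrite gt_eqF// powR_gt0// subr_gt0.
Qed.

Lemma fracI_integrable u f : smooth u f -> u < 0 ->
  mu.-integrable `]0, t[ (EFin \o (fun s => f s / (t - s) `^ alpha)).
Proof.
move=> sf u0; have [C hC] := smooth_bounded t sf u0.
have hk := integrable_scale C measurable_0t powR_kernel_integrable.
apply: le_integrable hk => //.
- apply/measurable_EFinP; apply: open_continuous_measurable_fun; first exact: open_0t.
  by move=> s; rewrite inE itv0tE => st; exact: kernel_continuous sf u0 st.
- move=> s; rewrite itv0tE => /andP[s0 st]; rewrite lee_fin /= !normrM.
  apply: ler_wpM2r; first exact: normr_ge0.
  by rewrite (le_trans (hC s _)) ?ler_norm// !ltW.
Qed.

End exhaust.

Lemma fracI_eq f g t : (forall s, 0 < s -> f s = g s) -> fracI alpha f t = fracI alpha g t.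
Proof.
move=> fg; apply: eq_Rintegral => s; rewrite inE itv0tE => /andP[s0 _].
by rewrite fg.
Qed.

Section smooth_frac.
Variable u : R.
Hypothesis u0 : u < 0.

Lemma fracID f g t : 0 < t -> smooth u f -> smooth u g ->
  fracI alpha (fun s => f s + g s) t = fracI alpha f t + fracI alpha g t.
Proof.
move=> t0 sf sg; rewrite /fracI -RintegralD; last 3 first.
- exact: measurable_0t.
- exact: fracI_integrable sf u0.
- exact: fracI_integrable sg u0.
by apply: eq_Rintegral => s _; rewrite mulrDl.
Qed.

Lemma fracIZ k f t : 0 < t -> smooth u f ->
  fracI alpha (fun s => k * f s) t = k * fracI alpha f t.
Proof.
move=> t0 sf; rewrite /fracI -RintegralZl; last 2 first.
- exact: measurable_0t.
- exact: fracI_integrable sf u0.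
by apply: eq_Rintegral => s _; rewrite mulrA.
Qed.

(** [fracI] transported to the fixed interval [(0, 1)] by [s = t v], which makes
    the dependence on [t] accessible to differentiation under the integral. *)
Definition unit_fracI (f : R -> R) (t : R) : R :=
  \int[mu]_(v in `]0, 1[) (f (t * v) / (1 - v) `^ alpha).

Lemma unit_fracIE f t : 0 < t -> smooth u f ->
  mu.-integrable `]0, 1[ (EFin \o (fun v => f (t * v) / (1 - v) `^ alpha)) /\
  fracI alpha f t = t `^ (1 - alpha) * unit_fracI f t.
Proof.
move=> t0 sf; have [i1 e1] := integrable_scaled t0 (fracI_integrable t0 sf u0).
have tal : t `^ alpha != 0 by rewrite gt_eqF// powR_gt0.
have kE v : `]0, 1[ v -> f (t * v) / (1 - v) `^ alpha =
    t `^ alpha * (f (t * v) / (t - t * v) `^ alpha).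
  rewrite itv0tE => /andP[v0 v1].
  have -> : t - t * v = t * (1 - v) by rewrite mulrBr mulr1.
  rewrite powRM; [|exact: ltW|by rewrite subr_ge0 ltW].
  by rewrite invfM mulrCA (mulrA (t `^ alpha)) mulfV// mul1r.
have i2 := integrable_scale (t `^ alpha) (measurable_0t 1) i1.
split.
  apply: eq_integrable i2; first exact: measurable_0t.
  by move=> v; rewrite inE => /kE /= ->.
rewrite /fracI e1 /unit_fracI.
have -> : \int[mu]_(v in `]0, 1[) (f (t * v) / (1 - v) `^ alpha) =
    \int[mu]_(v in `]0, 1[) (t `^ alpha * (f (t * v) / (t - t * v) `^ alpha)).
  by apply: eq_Rintegral => v; rewrite inE => /kE.
rewrite RintegralZl//.
rewrite mulrA -powRD; last by apply/implyP => _; rewrite gt_eqF.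
by rewrite subrK powRr1// ltW.
Qed.

(** The Euler operator [s d/ds] shifted by [r]. The Riemann-Liouville integral
    is homogeneous of degree [1 - alpha] under dilations of time, hence
    [t d/dt] acts on it as [euler_op (1 - alpha)] on the integrand. *)
Definition euler_op (r : R) (f : R -> R) (s : R) : R := s * derive1 f s + r * f s.

Lemma smooth_euler_op r f : smooth u f -> smooth u (euler_op r f).
Proof.
move=> sf; apply: smoothD; last exact: (@smoothZ _ u r f sf).
by apply: smoothM; [exact: smooth_id|exact: smooth_derive1].
Qed.

Lemma is_derive_unit_fracI f t : 0 < t -> smooth u f ->
  is_derive t 1 (unit_fracI f)
    (\int[mu]_(v in `]0, 1[) (v * derive1 f (t * v) / (1 - v) `^ alpha)).
Proof.
move=> t0 sf; have sf' := smooth_derive1 sf.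
have [C hC] := smooth_bounded (t + 1) sf' u0.
have It : `]0, t + 1[ t by rewrite itv0tE t0 ltrDl ltr01.
apply: (@is_derive_Rintegral _ _ (fun t v => f (t * v) / (1 - v) `^ alpha)
  (fun t v => v * derive1 f (t * v) / (1 - v) `^ alpha)
  (fun v => C * ((1 - v) `^ alpha)^-1) _ _ _ (measurable_0t 1) It).
- by move=> y; rewrite itv0tE => /andP[y0 _]; have [] := unit_fracIE y0 sf.
- move=> y v; rewrite !itv0tE => /andP[y0 _] /andP[v0 _].
  have uyv : u < v * y + 0 by rewrite addr0 (lt_trans u0)// mulr_gt0.
  have h := is_derive_comp_affine (smooth_is_derive sf uyv).
  have h2 := is_derive_scale (((1 - v) `^ alpha)^-1) h.
  have -> : (fun y => f (y * v) / (1 - v) `^ alpha) =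
      (fun y => ((1 - v) `^ alpha)^-1 * f (v * y + 0)) :> (R -> R).
    by apply/funext => z; rewrite addr0 mulrC (mulrC z).
  by apply: (is_derive_eq h2); rewrite addr0 mulrC (mulrC v y).
- exact: integrable_scale (measurable_0t 1) (powR_kernel_integrable ltr01).
- move=> y v; rewrite !itv0tE => /andP[y0 y1] /andP[v0 v1]; rewrite !normrM.
  rewrite [X in _ * X]ger0_norm ?invr_ge0 ?powR_ge0//.
  apply: ler_wpM2r; first by rewrite invr_ge0 powR_ge0.
  rewrite -[leRHS]mul1r ler_pM//; first by rewrite ger0_norm ltW.
  apply: hC; apply/andP; split; first exact/ltW/mulr_gt0.
  by apply: (@le_trans _ _ y); [rewrite ler_piMr// ltW|exact: ltW].
Qed.

(** Differentiate [t^(1 - alpha) * unit_fracI f t] as a product. *)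
Lemma is_derive_fracI f t : 0 < t -> smooth u f ->
  is_derive t 1 (fracI alpha f) (t^-1 * fracI alpha (euler_op (1 - alpha) f) t).
Proof.
move=> t0 sf; have sE : smooth u (euler_op (1 - alpha) f) := smooth_euler_op sf.
have h := is_derive_mul (is_derive1_powR (1 - alpha) t0) (is_derive_unit_fracI t0 sf).
have hn : \forall y \near t, y `^ (1 - alpha) * unit_fracI f y = fracI alpha f y.
  by have := lt_nbhsr t0; apply: filterS => y y0; have [_ ->] := unit_fracIE y0 sf.
have h1 := near_eq_is_derive hn h.
apply: (is_derive_eq h1); have [iE ->] := unit_fracIE t0 sE.
set J' := (\int[mu]_(v in _) _).
have [i0 _] := unit_fracIE t0 sf.
have -> : unit_fracI (euler_op (1 - alpha) f) t = t * J' + (1 - alpha) * unit_fracI f t.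
  have [C hC] := smooth_bounded t (smooth_derive1 sf) u0.
  have [i1 _] := unit_fracIE t0 (smoothM (@smooth_id _ u) (smooth_derive1 sf)).
  have kE v : t * v * derive1 f (t * v) / (1 - v) `^ alpha =
    t * (v * derive1 f (t * v) / (1 - v) `^ alpha) by rewrite !mulrA.
  have i2 : mu.-integrable `]0, 1[
      (EFin \o (fun v => v * derive1 f (t * v) / (1 - v) `^ alpha)).
    have := integrable_scale t^-1 (measurable_0t 1) i1.
    congr (mu.-integrable _ _); apply/funext => v /=.
    by rewrite kE mulrA mulVf ?gt_eqF// mul1r.
  rewrite /J' -!RintegralZl//; try exact: measurable_0t.
  rewrite -RintegralD; last 3 first.
  - exact: measurable_0t.
  - exact: integrable_scale (measurable_0t 1) i2.
  - exact: integrable_scale (measurable_0t 1) i0.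
  apply: eq_Rintegral => v _; rewrite /euler_op mulrDl kE; congr (_ + _).
  by rewrite mulrA.
have pE : t `^ (1 - alpha) = t * t `^ (1 - alpha - 1).
  rewrite -[X in X * _]powRr1 ?ltW// -powRD; last by apply/implyP => _; rewrite gt_eqF.
  by congr (_ `^ _); ring.
by rewrite pE; field; rewrite gt_eqF.
Qed.

Lemma smooth_fracI f : smooth u f -> smooth 0 (fracI alpha f).
Proof.
move=> sf n; elim: n f sf => [|n ih] f sf; first by move=> ? ?; rewrite ltn0.
refine (@smoothnS_derive _ _ _ _
  (fun t => t^-1 * fracI alpha (euler_op (1 - alpha) f) t) _ _).
  by move=> t t0; exact: is_derive_fracI.
have sV : smooth 0 (fun y : R => y^-1).
  by apply: smoothV; [move=> t t0; rewrite gt_eqF|exact: smooth_id].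
exact: (smoothnM (sV n) (ih _ (smooth_euler_op sf))).
Qed.

(** Since the factor [1 / t] of [is_derive_fracI] is itself differentiated, the
    shift decreases by 1 at each step. *)
Fixpoint euler_iter (n : nat) (f : R -> R) : R -> R :=
  if n is n'.+1 then euler_op (1 - alpha - n'%:R) (euler_iter n' f) else f.

Lemma smooth_euler_iter n f : smooth u f -> smooth u (euler_iter n f).
Proof. by move=> sf; elim: n => [|n ih] //=; exact: smooth_euler_op. Qed.

Lemma derive1n_fracI n f t : smooth u f -> 0 < t ->
  derive1n n (fracI alpha f) t = (t^-1) ^+ n * fracI alpha (euler_iter n f) t.
Proof.
move=> sf; elim: n t => [t _|n ih t t0]; first by rewrite expr0 mul1r.
rewrite derive1nS (eq_derive1_gt ih t0).
have sn : smooth u (euler_iter n f) := smooth_euler_iter sf.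
have hV : is_derive t 1 (fun y : R => y^-1 ^+ n) (- n%:R * t^-1 ^+ n.+1).
  elim: n {ih sn} => [|n ihn].
    rewrite oppr0 mul0r; have := is_derive_cst (1 : R) t 1.
    by congr (is_derive _ _ _ _); apply/funext => y; rewrite expr0.
  have t1 : t != 0 by rewrite gt_eqF.
  have h := is_derive_mul (is_derive_inv t1 (is_derive_id t 1)) ihn.
  have -> : (fun y : R => y^-1 ^+ n.+1) = (fun y : R => y^-1 * y^-1 ^+ n).
    by apply/funext => y; rewrite exprS.
  by apply: (is_derive_eq h); rewrite -natr1 !exprS; ring.
rewrite (derive1_is_derive (is_derive_mul hV (is_derive_fracI t0 sn))) /=.
have -> : fracI alpha (euler_op (1 - alpha - n%:R) (euler_iter n f)) t =
    fracI alpha (euler_op (1 - alpha) (euler_iter n f)) t -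
    n%:R * fracI alpha (euler_iter n f) t.
  have sE : smooth u (euler_op (1 - alpha) (euler_iter n f)) := smooth_euler_op sn.
  have sN := @smoothZ _ u (- n%:R) _ sn.
  rewrite -mulNr -(fracIZ _ t0 sn) -(fracID t0 sE sN).
  by apply: fracI_eq => s _; rewrite /euler_op; ring.
by rewrite exprS; ring.
Qed.

(** In general the derivative of [fracI alpha f] has the extra term
    [f 0 * t^(- alpha)]. By [is_derive_fracI] the claim is that
    [(t f' - euler_op (1 - alpha) f) / (t - s)^alpha] integrates to 0 over
    [(0, t)]; it is the derivative of [f s * (t - s)^(1 - alpha)], which vanishes
    at both ends. *)
Lemma derive1_fracI0 f t : smooth u f -> f 0 = 0 -> 0 < t ->
  derive1 (fracI alpha f) t = fracI alpha (derive1 f) t.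
Proof.
move=> sf f0 t0; rewrite (derive1_is_derive (is_derive_fracI t0 sf)).
have sf' := smooth_derive1 sf.
have sE : smooth u (euler_op (1 - alpha) f) := smooth_euler_op sf.
pose h s := f s * (t - s) `^ (1 - alpha).
pose h' s := (t * derive1 f s + -1 * euler_op (1 - alpha) f s) / (t - s) `^ alpha.
have st' : smooth u (fun s => t * derive1 f s) by exact: (@smoothZ _ u t _ sf').
have sNE : smooth u (fun s => -1 * euler_op (1 - alpha) f s) by exact: (@smoothZ _ u (-1) _ sE).
have sh := smoothD st' sNE.
have ih' : mu.-integrable `]0, t[ (EFin \o h') := fracI_integrable t0 sh u0.
have dh s : (`]0, t[ : set R) s -> is_derive s 1 h (h' s).
  rewrite itv0tE => /andP[s0 st].
  have us : u < s by exact: lt_trans s0.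
  have H := is_derive_mul (smooth_is_derive sf us) (is_derive_powR_sub (1 - alpha) st).
  apply: (is_derive_eq H); rewrite /h' /euler_op.
  have ts : 0 < t - s by rewrite subr_gt0.
  have -> : 1 - alpha - 1 = - alpha by ring.
  have -> : (t - s) `^ (1 - alpha) = (t - s) / (t - s) `^ alpha.
    by rewrite powRB; [rewrite powRr1// ltW|apply/implyP => _; rewrite gt_eqF].
  by rewrite powRN; field; rewrite gt_eqF// powR_gt0.
have ch' s : (`]0, t[ : set R) s -> {for s, continuous h'}.
  by rewrite itv0tE => st; exact: kernel_continuous sh u0 st.
have ha : h (t * expR (- n.+1%:R)) @[n --> \oo] --> (0 : R).
  have ch : {for 0, continuous h}.
    apply: continuousM; first exact: smooth_continuous sf u0.
    exact: continuous_powR_sub.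
  have h0 : h 0 = 0 by rewrite /h f0 mul0r.
  rewrite -[X in _ --> X]h0; apply: (continuous_cvg _ ch); exact: exhaust_a.
have hb : h (t - t * expR (- n.+1%:R)) @[n --> \oo] --> (0 : R).
  have [C hC] := smooth_bounded t sf u0.
  have C0 : 0 <= C by apply: le_trans (hC 0 _); rewrite ?normr_ge0// lexx ltW.
  pose r := expR (- (1 - alpha)).
  have hr : (C * t `^ (1 - alpha)) * r ^+ n.+1 @[n --> \oo] --> (0 : R).
    rewrite -[X in _ --> X](mulr0 (C * t `^ (1 - alpha))); apply: cvgM; first exact: cvg_cst.
    rewrite (cvg_shiftS (fun n => r ^+ n)); apply: cvg_expr.
    by rewrite ger0_norm ?expR_ge0// -expR0 ltr_expR oppr_lt0.
  apply/norm_cvg0P; apply: (@squeeze_cvgr _ _ _ _ (fun=> 0)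
    (fun n => (C * t `^ (1 - alpha)) * r ^+ n.+1)) => //; last exact: cvg_cst.
  apply: nearW => n; rewrite normr_ge0/= /h normrM.
  have -> : t - (t - t * expR (- n.+1%:R)) = t * expR (- n.+1%:R) by ring.
  have /andP[p0 pt] := exhaust_pos t0 n.
  rewrite [X in _ * X]ger0_norm ?powR_ge0// powRM ?expR_ge0//; last exact: ltW.
  rewrite mulrA; apply: ler_pM; rewrite ?mulr_ge0 ?powR_ge0//.
    apply: ler_wpM2r; first exact: powR_ge0.
    by apply: hC; move: p0 pt; lra.
  rewrite /r -expRM_natl /powR expR_eq0 expRK.
  by rewrite ler_expR !mulrN mulrC.
have := integral_derive (@open_0t t) (exhaust_lt t0) (exhaust_sub t0)
  (@exhaust_cover t) dh ch' ih' ha hb.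
rewrite subr0 -/(fracI alpha _ t) fracID// fracIZ// fracIZ//.
move=> e; have {}e : t * fracI alpha (derive1 f) t = fracI alpha (euler_op (1 - alpha) f) t.
  by move: e; lra.
by rewrite -e mulrA mulVf ?gt_eqF// mul1r.
Qed.

End smooth_frac.

End fractional.

(** * Interchange of fractional derivation and integration in the state variable *)

Section Fubini_dominated.
Context {R : realType}.
Notation mu := (@lebesgue_measure R).

(** A product majorant [U x * V s] makes [G] integrable on the product. *)
Lemma Fubini_dominated (G : measurableTypeR R * measurableTypeR R -> R)
    (U V : R -> R) :
  measurable_fun setT G ->
  mu.-integrable setT (EFin \o U) -> mu.-integrable setT (EFin \o V) ->
  (forall x s, `|G (x, s)| <= U x * V s) ->
  mu.-integrable setT (EFin \o (fun x => \int[mu]_s G (x, s))) /\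
  \int[mu]_x (\int[mu]_s G (x, s)) = \int[mu]_s (\int[mu]_x G (x, s)).
Proof.
move=> mG iU iV GUV.
have mEG : measurable_fun setT (EFin \o G) by exact/measurable_EFinP.
have mGx x : measurable_fun setT (fun s => G (x, s)) by exact: measurableT_comp.
have mGs s : measurable_fun setT (fun x => G (x, s)) by exact: measurableT_comp.
have iGx x : mu.-integrable setT (fun s => (G (x, s))%:E).
  apply: le_integrable (integrable_scale (U x) measurableT iV) => //.
    exact/measurable_EFinP.
  by move=> s _; rewrite lee_fin /= (le_trans (GUV x s))// ler_norm.
have iGs s : mu.-integrable setT (fun x => (G (x, s))%:E).
  apply: le_integrable (integrable_scale (V s) measurableT iU) => //.
    exact/measurable_EFinP.
  by move=> x _; rewrite lee_fin /= (le_trans (GUV x s))// mulrC ler_norm.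
have iG : (product_measure1 mu mu).-integrable setT (EFin \o G).
  apply/(integrable12ltyP _ _ mEG).
  pose B := \int[mu]_s `|V s|.
  have iNV := integrable_norm iV.
  have h x : (\int[mu]_s `|(EFin \o G) (x, s)| <= (`|U x| * B)%:E)%E.
    apply: (@le_trans _ _ (\int[mu]_s (`|U x| * `|V s|)%:E)%E).
      apply: ge0_le_integral => //.
      - by apply/measurable_EFinP; apply: measurableT_comp => //.
      - apply/measurable_EFinP; apply: measurable_funM => //.
        apply: measurableT_comp => //.
        by apply/measurable_EFinP; exact: (measurable_int mu iV).
      - move=> s _; rewrite /= lee_fin (le_trans (GUV x s))//.
        by rewrite -normrM ler_norm.
    under eq_integral do rewrite EFinM.
    rewrite integralZl// /B /Rintegral EFinM fineK//.
    by have := integrable_fin_num measurableT iNV.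
  apply: (@le_lt_trans _ _ (\int[mu]_x (`|U x| * B)%:E)%E).
    apply: ge0_le_integral => //.
    - by move=> x _; exact: integral_ge0.
    - apply: (@measurable_fun_fubini_tonelli_F _ _ _ _ R mu (abse \o (EFin \o G))).
        exact: measurableT_comp.
      by move=> p; exact: abse_ge0.
    - apply/measurable_EFinP; apply: measurable_funM => //.
      apply: measurableT_comp => //.
      by apply/measurable_EFinP; exact: (measurable_int mu iU).
  have iNU := integrable_norm iU.
  under eq_integral do rewrite EFinM.
  rewrite integralZr// muleC lte_mul_pinfty ?lee_fin//.
    by apply: Rintegral_ge0.
  by have := integrable_lty measurableT iNU.
have e1 x : (\int[mu]_s G (x, s))%:E = (\int[mu]_s (G (x, s))%:E)%E.
  by rewrite /Rintegral fineK//; have := integrable_fin_num measurableT (iGx x).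
have e2 s : (\int[mu]_x G (x, s))%:E = (\int[mu]_x (G (x, s))%:E)%E.
  by rewrite /Rintegral fineK//; have := integrable_fin_num measurableT (iGs s).
split.
  have := integrable_fubini_F iG.
  by congr (mu.-integrable _ _); apply/funext => x /=; rewrite e1.
rewrite /Rintegral; congr fine.
under eq_integral do rewrite e1.
under [RHS]eq_integral do rewrite e2.
exact: Fubini iG.
Qed.

End Fubini_dominated.

Section family_fractional.
Context {R : realType}.
Notation mu := (@lebesgue_measure R).
Variables (a b e u : R) (q : R -> R) (Cq alpha : R).
Hypothesis a0 : 0 < a.
Hypothesis b0 : 0 < b.
Hypothesis mq : measurable_fun (`]0, +oo[ : set R) q.
Hypothesis qC : forall x, 0 < x -> `|q x| <= Cq.
Hypothesis u0 : forall s, u < s -> 0 < b * s + e.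
Hypothesis ult0 : u < 0.
Hypothesis alpha01 : 0 < alpha < 1.

Let e0 : 0 < e. Proof. by have := u0 ult0; rewrite mulr0 add0r. Qed.

(** The exponent [b * s + e] stays in the compact interval [[e, b * t + e]] of
    positive numbers for [s] in [(0, t)], so one log-logistic majorant in [x]
    times the integrable kernel in [s] dominates the double integrand. *)
Lemma term_fracI c i t : 0 < t -> smooth u c ->
  let phi := fun x s => c s * mellin_kernel a i (b * s + e) x in
  mu.-integrable `]0, +oo[ (EFin \o (fun x => q x * fracI alpha (phi x) t)) /\
  \int[mu]_(x in `]0, +oo[) (q x * fracI alpha (phi x) t) =
  fracI alpha (fun s => c s * mellin a q i (b * s + e)) t.
Proof.
move=> t0 sc phi.
pose D1 : set (measurableTypeR R) := `]0, +oo[.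
pose D2 : set (measurableTypeR R) := `]0, t[.
have mD1 : measurable D1 by exact: measurable_itv.
have mD2 : measurable D2 by exact: measurable_itv.
pose k s := c s / (t - s) `^ alpha.
have ik : mu.-integrable D2 (EFin \o k) := fracI_integrable alpha01 t0 sc ult0.
pose Q := q \_ D1; pose W := k \_ D2.
have mQ : measurable_fun setT Q by exact/(measurable_restrictT _ mD1).
have iW : mu.-integrable setT (EFin \o W).
  by rewrite -restrict_EFin; apply/integrable_restrict => //; rewrite setTI.
have mW : measurable_fun setT W.
  by apply/measurable_EFinP; exact: (measurable_int mu iW).
pose G (p : measurableTypeR R * measurableTypeR R) : R :=
  Q p.1 * mellin_kernel a i (b * p.2 + e) p.1 * W p.2.
have mG : measurable_fun setT G.
  apply: measurable_funM; last exact: measurableT_comp.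
  apply: measurable_funM; first exact: measurableT_comp.
  have mln : measurable_fun setT (fun p : measurableTypeR R * measurableTypeR R => ln p.1).
    by apply: (measurableT_comp (@measurable_ln R)).
  apply: measurable_funM; first exact: measurable_funX.
  apply: measurableT_comp; first exact: measurable_expR.
  apply: measurable_funB; last exact: measurable_funM.
  apply: measurable_funM => //; apply: measurable_funB => //.
  by apply: measurable_funD => //; exact: measurable_funM.
have [C C0 hC] := @mellin_kernel_dominated R a e (b * t + e) i a0 e0.
have Cq0 : 0 <= Cq by exact: le_trans (qC ltr01).
pose l := loglogistic (e / 2).
have il : mu.-integrable setT (EFin \o (l \_ D1)).
  rewrite -restrict_EFin; apply/integrable_restrict => //; rewrite setTI.
  by apply: loglogistic_integrable; rewrite divr_gt0.
pose U x := (Cq * C) * (l \_ D1) x.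
have iU : mu.-integrable setT (EFin \o U) by exact: integrable_scale.
pose V s := `|W s|.
have iV : mu.-integrable setT (EFin \o V).
  have := integrable_norm iW; by congr (mu.-integrable _ _).
have GUV x s : `|G (x, s)| <= U x * V s.
  rewrite /G /U /V /= normrM; rewrite /W !patchE.
  have [sD|] := boolP (s \in D2); last by rewrite normr0 !mulr0.
  apply: ler_wpM2r; first exact: normr_ge0.
  rewrite /Q patchE; have [xD|] := boolP (x \in D1); last first.
    by rewrite mul0r normr0 mulr0.
  have x0 : 0 < x by move: xD; rewrite inE /D1 itv0y.
  have /andP[s0 st] : 0 < s < t by move: sD; rewrite inE /D2 itv0tE.
  rewrite normrM -mulrA; apply: ler_pM => //; first exact: qC.
  apply: hC => //; rewrite lerDr mulr_ge0//=; try exact: ltW.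
  by rewrite lerD2r ler_pM2l// ltW.
have [iF FF] := Fubini_dominated mG iU iV GUV.
have eL x : \int[mu]_s G (x, s) = ((fun x => q x * fracI alpha (phi x) t) \_ D1) x.
  rewrite patchE; have [xD|xD] := boolP (x \in D1); last first.
    rewrite /G /Q; under eq_Rintegral do rewrite /= patchE (negbTE xD) mul0r mul0r.
    by rewrite /Rintegral integral0.
  have -> : (fun s => G (x, s)) = (fun s => q x * (phi x s / (t - s) `^ alpha)) \_ D2.
    apply/funext => s; rewrite /G /= /Q /W !patchE xD /phi /k.
    by case: (s \in D2); [ring|rewrite mulr0].
  have sphi : smooth u (phi x).
    apply: smoothM; first exact: sc.
    move=> n; elim: n i {G mG C C0 hC U iU GUV iF FF phi} => [|n ih] i.
      by move=> ? ?; rewrite ltn0.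
    refine (@smoothnS_derive _ _ _ _ (fun s => b * mellin_kernel a i.+1 (b * s + e) x) _ _).
      by move=> s _; exact: (is_derive_comp_affine (is_derive_mellin_kernel a i (b * s + e) x)).
    exact: (smoothnM (@smooth_cst R u b n) (ih i.+1)).
  rewrite -Rintegral_mkcond [LHS]RintegralZl; [by []|exact: mD2|].
  exact: (fracI_integrable alpha01 t0 sphi ult0).
have eR s : \int[mu]_x G (x, s) =
    ((fun s => c s * mellin a q i (b * s + e) / (t - s) `^ alpha) \_ D2) s.
  rewrite patchE; have [sD|sD] := boolP (s \in D2); last first.
    rewrite /G /W; under eq_Rintegral do rewrite /= patchE (negbTE sD) mulr0.
    by rewrite /Rintegral integral0.
  have /andP[s0 st] : 0 < s < t by move: sD; rewrite inE /D2 itv0tE.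
  have -> : (fun x => G (x, s)) =
      (fun x => k s * (q x * mellin_kernel a i (b * s + e) x)) \_ D1.
    apply/funext => x; rewrite /G /= /Q /W !patchE sD.
    by case: (x \in D1); [ring|rewrite mul0r mul0r].
  rewrite -Rintegral_mkcond [LHS]RintegralZl; [|exact: mD1|].
    by rewrite /k /mellin [LHS]mulrAC.
  apply: (mellin_integrable a0 mq qC); apply: u0; exact: lt_trans s0.
split.
  have : mu.-integrable setT (EFin \o ((fun x => q x * fracI alpha (phi x) t) \_ D1)).
    by move: iF; congr (mu.-integrable _ _); apply/funext => x /=; rewrite eL.
  by rewrite -restrict_EFin => /integrable_restrict; rewrite setTI; apply.
rewrite Rintegral_mkcond [RHS]Rintegral_mkcond.
transitivity (\int[mu]_x (\int[mu]_s G (x, s))).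
  by apply: eq_Rintegral => x _; rewrite eL.
by rewrite FF; apply: eq_Rintegral => s _; rewrite eR.
Qed.

Lemma family_fracI phi Phi t : 0 < t -> family a b e u q phi Phi ->
  mu.-integrable `]0, +oo[ (EFin \o (fun x => q x * fracI alpha (phi x) t)) /\
  \int[mu]_(x in `]0, +oo[) (q x * fracI alpha (phi x) t) = fracI alpha Phi t.
Proof.
move=> t0; elim=> [c i sc|p1 P1 p2 P2 f1 [i1 e1] f2 [i2 e2]].
  exact: term_fracI.
have [s1 S1] := family_smooth a0 mq qC u0 f1.
have [s2 S2] := family_smooth a0 mq qC u0 f2.
have -> : (fun x => q x * fracI alpha (fun s => p1 x s + p2 x s) t) =
    (fun x => q x * fracI alpha (p1 x) t + q x * fracI alpha (p2 x) t).
  by apply/funext => x; rewrite (fracID alpha01 ult0 t0 (s1 x) (s2 x)) mulrDr.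
split.
  have := integrableD measurable_gt0 i1 i2.
  by congr (mu.-integrable _ _); apply/funext => x /=; rewrite EFinD.
by rewrite RintegralD ?e1 ?e2 ?(fracID alpha01 ult0 t0 S1 S2)//; exact: measurable_itv.
Qed.

Lemma family_euler_iter n phi Phi : family a b e u q phi Phi ->
  exists phi' Phi', [/\ family a b e u q phi' Phi',
    forall x s, u < s -> euler_iter alpha n (phi x) s = phi' x s &
    forall s, u < s -> euler_iter alpha n Phi s = Phi' s].
Proof.
move=> f; elim: n => [|n [p [P [f1 d1 D1]]]]; first by exists phi, Phi.
have [p' [P' [f2 d2 D2]]] := family_derive a0 mq qC u0 f1.
have f3 := family_mul (@smooth_id R u) f2.
have f4 := family_mul (@smooth_cst R u (1 - alpha - n%:R)) f1.
eexists; eexists; split; first exact: (family_add f3 f4).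
- move=> x s us /=; rewrite /euler_op (eq_derive1_gt (d1 x) us) d1//.
  by rewrite (derive1_is_derive (d2 x s us)).
- move=> s us /=; rewrite /euler_op (eq_derive1_gt D1 us) D1//.
  by rewrite (derive1_is_derive (D2 s us)).
Qed.

(** The [n]-th derivative of the Riemann-Liouville integral is again, up to a
    power of [t], such an integral of a member of the same class, so that
    Fubini's theorem is needed only for the integral itself. *)
Lemma family_derive1n_fracI n phi Phi t : 0 < t -> family a b e u q phi Phi ->
  mu.-integrable `]0, +oo[
    (EFin \o (fun x => q x * derive1n n (fracI alpha (phi x)) t)) /\
  \int[mu]_(x in `]0, +oo[) (q x * derive1n n (fracI alpha (phi x)) t) =
  derive1n n (fracI alpha Phi) t.
Proof.
move=> t0 f; have [s1 S1] := family_smooth a0 mq qC u0 f.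
have [p [P [f' d D]]] := family_euler_iter n f.
have [iF eF] := family_fracI t0 f'.
have iF' := integrable_scale (t^-1 ^+ n) measurable_gt0 iF.
have -> : (fun x => q x * derive1n n (fracI alpha (phi x)) t) =
    (fun x => t^-1 ^+ n * (q x * fracI alpha (p x) t)).
  apply/funext => x; rewrite (derive1n_fracI alpha01 ult0 _ (s1 x) t0) mulrCA.
  by congr (_ * (_ * _)); apply: fracI_eq => s s0; rewrite d// (lt_trans ult0).
split=> //; rewrite RintegralZl//.
rewrite (derive1n_fracI alpha01 ult0 _ S1 t0) eF; congr (_ * _).
by apply: fracI_eq => s s0; rewrite D// (lt_trans ult0).
Qed.

End family_fractional.

(** * The law of the time-changed process *)

Section grid.
Context {R : realType}.

Definition grid_cell (N j : nat) : set R := `[j%:R / N.+1%:R, j.+1%:R / N.+1%:R[.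

Definition grid_idx (N : nat) (x : R) : nat := Num.truncn (x * N.+1%:R).

(** The right end of the cell of [x]: approaching [x] strictly from the right
    is what right-continuous paths require. *)
Definition grid_up (N : nat) (x : R) : R := (grid_idx N x).+1%:R / N.+1%:R.

Lemma grid_cellP N x j : 0 <= x -> grid_cell N j x <-> grid_idx N x = j.
Proof.
move=> x0; have xN0 : 0 <= x * N.+1%:R by rewrite mulr_ge0.
have := truncn_itv xN0; rewrite -/(grid_idx N x) => /andP[h1 h2].
rewrite /grid_cell /= in_itv/= ler_pdivrMr// ltr_pdivlMr//.
split=> [/andP[h3 h4]|<-]; last by rewrite h1.
have := le_lt_trans h1 h4; have := le_lt_trans h3 h2; rewrite !ltr_nat; lia.
Qed.

Lemma grid_cell_ge0 N j x : grid_cell N j x -> 0 <= x.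
Proof. by rewrite /grid_cell /= in_itv/= => /andP[+ _]; apply: le_trans; rewrite divr_ge0. Qed.

Lemma grid_bigcup N : \bigcup_j grid_cell N j = `[0, +oo[.
Proof.
apply/seteqP; split=> x /=.
  by move=> [j _ /grid_cell_ge0]; rewrite in_itv/= andbT.
by rewrite in_itv/= andbT => x0; exists (grid_idx N x) => //; apply/grid_cellP.
Qed.

Lemma grid_trivIset N : trivIset setT (grid_cell N).
Proof.
move=> i j _ _ [x [xi xj]]; have x0 := grid_cell_ge0 xi.
by rewrite -((grid_cellP N i x0).1 xi) -((grid_cellP N j x0).1 xj).
Qed.

Lemma measurable_grid_cell N j : measurable (grid_cell N j : set (measurableTypeR R)).
Proof. exact: measurable_itv. Qed.

Lemma grid_up_itv N x : 0 <= x -> x < grid_up N x <= x + N.+1%:R^-1.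
Proof.
move=> x0; have xN0 : 0 <= x * N.+1%:R by rewrite mulr_ge0.
have := truncn_itv xN0; rewrite -/(grid_idx N x) => /andP[h1 h2].
rewrite /grid_up ltr_pdivlMr// h2/= ler_pdivrMr// mulrDl mulVf//.
by rewrite -natr1 lerD2r.
Qed.

Lemma grid_up_gt0 N x : 0 < grid_up N x.
Proof. by rewrite divr_gt0. Qed.

(** A right-continuous integer-valued function is constant just to the right of
    [x], where the grid points above [x] eventually lie. *)
Lemma right_continuous_grid (f : R -> nat) x : 0 <= x ->
  (f s)%:R @[s --> x^'+] --> ((f x)%:R : R) ->
  \forall N \near \oo, f (grid_up N x) = f x.
Proof.
move=> x0 /cvgrPdist_lt /(_ 1 ltr01) [e /= e0 he].
have : \forall N \near \oo, e^-1 < N%:R by exact: nbhs_infty_gtr.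
apply: filterS => N hN; have /andP[h1 h2] := grid_up_itv N x0.
have h3 : N.+1%:R^-1 < e.
  by rewrite invf_plt ?posrE// (lt_trans hN)// ltr_nat.
have h5 : `|x - grid_up N x| < e.
  rewrite distrC ger0_norm; last by rewrite subr_ge0 ltW.
  by rewrite ltrBlDl; apply: le_lt_trans h2 _; rewrite ltrD2l.
have h6 : `|(f x)%:R - (f (grid_up N x))%:R| < 1 :> R := he _ h5 h1.
move: h6; rewrite ltr_norml => /andP[h6 h7].
apply/eqP; rewrite eqn_leq; apply/andP; split; rewrite -ltnS -(ltr_nat R) -natr1; lra.
Qed.

End grid.

Section events.
Context {d : measure_display} {T : measurableType d} {R : realType}.
Variable P : probability T R.

(** Events whose indicators converge pointwise: the limit is measurable as a
    lower limit, and the probabilities converge by dominated convergence. *)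
Lemma cvg_probability (A_ : nat -> set T) (A : set T) :
  (forall N, measurable (A_ N)) ->
  (forall w, \forall N \near \oo, A_ N w <-> A w) ->
  measurable A /\ fine (P (A_ N)) @[N --> \oo] --> fine (P A).
Proof.
move=> mA_ AA.
have AE : A = \bigcup_n \bigcap_(k >= n) A_ k.
  apply/seteqP; split=> w; have [n _ hn] := AA w.
    by move=> Aw; exists n => // k /= nk; exact/(hn k nk).2.
  by move=> [m _ hm]; apply: (hn (maxn n m) (leq_maxl _ _)).1; apply: hm; exact: leq_maxr.
have mA : measurable A.
  rewrite AE; apply: bigcup_measurable => n _.
  by apply: bigcap_measurable => //; exists n => /=.
split=> //.
have h : (\int[P]_w (\1_(A_ N) w)%:E @[N --> \oo] --> \int[P]_w (\1_A w)%:E)%E.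
  apply: (@dominated_cvg _ _ _ P setT measurableT _ _ (fun=> 1%E)) => //.
  - by move=> N; apply/measurable_EFinP; exact: measurable_indic.
  - move=> w _; apply: cvg_near_cst; have := AA w; apply: filterS => N hN.
    rewrite !indicE; congr (_%:R%:E); congr nat_of_bool.
    by apply/idP/idP; rewrite !inE => /hN.
  - exact: finite_measure_integrable_cst.
  - by move=> N w _; rewrite lee_fin indicE; case: (_ \in _); rewrite ?normr1 ?normr0.
have hE B : measurable B -> (\int[P]_w (\1_B w)%:E)%E = P B.
  by move=> mB; rewrite integral_indic// setIT.
rewrite hE// in h; have e : (fun N => \int[P]_w (\1_(A_ N) w)%:E)%E = P \o A_.
  by apply/funext => N; rewrite hE.
rewrite e in h; apply: fine_cvg; rewrite fineK//; exact: fin_num_measure.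
Qed.

Variables (M : R -> T -> nat).
Hypothesis mM : forall t, 0 <= t -> measurable_fun setT (M t).
Hypothesis rM : right_continuous_paths (real_process M).

Lemma measurable_state n t : 0 <= t -> measurable [set w | M t w = n].
Proof.
by move=> t0; have := mM t0 measurableT (Y := [set n]); rewrite setTI; apply.
Qed.

Lemma pmf_grid n t : 0 <= t ->
  pmf_at P M n (grid_up N t) @[N --> \oo] --> pmf_at P M n t.
Proof.
move=> t0; apply: (cvg_probability (A_ := fun N => [set w | M (grid_up N t) w = n]) _ _).2.
  by move=> N; apply: measurable_state; exact/ltW/grid_up_gt0.
move=> w; have := right_continuous_grid t0 (@rM w t t0).
by apply: filterS => N /= ->.
Qed.

Lemma measurable_pmf_grid n N :
  measurable_fun (`[0, +oo[ : set R) (fun x => pmf_at P M n (grid_up N x)).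
Proof.
rewrite -(grid_bigcup N); apply/measurable_fun_bigcup.
  by move=> j; exact: measurable_grid_cell.
move=> j; apply: (eq_measurable_fun (fun=> pmf_at P M n (j.+1%:R / N.+1%:R))) => //.
move=> x; rewrite inE => xj; have x0 := grid_cell_ge0 xj.
by rewrite /grid_up ((grid_cellP N j x0).1 xj).
Qed.

(** A pointwise limit of the step functions obtained by rounding time up to the
    grid. *)
Lemma measurable_pmf n : measurable_fun (`[0, +oo[ : set R) (pmf_at P M n).
Proof.
apply: (measurable_fun_cvg (h := fun N x => pmf_at P M n (grid_up N x))).
  by move=> N; exact: measurable_pmf_grid.
by move=> x; rewrite /= in_itv/= andbT; exact: pmf_grid.
Qed.

Lemma pmf_ge0 n t : 0 <= pmf_at P M n t.
Proof. exact: fine_ge0. Qed.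

Lemma pmf_le1 n t : 0 <= t -> pmf_at P M n t <= 1.
Proof.
move=> t0; rewrite -lee_fin fineK; first exact/probability_le1/measurable_state.
by apply: fin_num_measure; exact: measurable_state.
Qed.

Lemma pmf_fineK n t : 0 <= t -> (pmf_at P M n t)%:E = P [set w | M t w = n].
Proof. by move=> t0; rewrite fineK//; apply: fin_num_measure; exact: measurable_state. Qed.

Section time_change.
Variables (Z : R -> T -> R) (g : R -> R) (t : R) (n : nat).
Hypothesis mZ : measurable_fun setT (Z t).
Hypothesis Z0 : forall w, 0 <= Z t w.
Hypothesis t0 : 0 < t.
Hypothesis indep : independent_processes P (real_process M) Z.
Hypothesis mg : measurable_fun setT g.
Hypothesis g0 : forall x, 0 <= g x.
Hypothesis gZ : forall B, measurable B ->
  (P (Z t @^-1` B) = \int[lebesgue_measure]_(x in B `&` `]0%R, +oo[) (g x)%:E)%E.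

Let mZB (B : set (measurableTypeR R)) : measurable B -> measurable (Z t @^-1` B).
Proof. by move=> mB; have := mZ measurableT mB; rewrite setTI; apply. Qed.

Lemma density_integrable : lebesgue_measure.-integrable `]0, +oo[ (EFin \o g).
Proof.
apply/integrableP; split; first exact/measurable_EFinP/measurable_funTS.
under eq_integral do rewrite /= ger0_norm//.
have := gZ measurableT; rewrite setTI preimage_setT probability_setT => <-.
exact: ltry.
Qed.

Lemma independent_states s (B : set (measurableTypeR R)) : 0 <= s -> measurable B ->
  P ([set w | M s w = n] `&` Z t @^-1` B) =
  (P [set w | M s w = n] * P (Z t @^-1` B))%E.
Proof.
move=> s0 mB.
have := @indep 1%N 1%N (fun=> s) (fun=> t) (fun=> [set n%:R]) (fun=> B)
  (fun=> s0) (fun=> ltW t0) (fun=> measurable_set1 _) (fun=> mB).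
rewrite !II1 !bigcap_set1.
have -> : real_process M s @^-1` [set n%:R] = [set w | M s w = n] :> set T; last by [].
apply/seteqP; split=> w /=; rewrite /real_process; last by move=> ->.
by move=> /eqP; rewrite eqr_nat => /eqP.
Qed.

Let A_ N := [set w | M (grid_up N (Z t w)) w = n].

Let A_E N : A_ N = \bigcup_j ([set w | M (j.+1%:R / N.+1%:R) w = n] `&`
  Z t @^-1` grid_cell N j).
Proof.
apply/seteqP; split=> w /=.
  by move=> h; exists (grid_idx N (Z t w)) => //; split => //; apply/grid_cellP.
move=> [j _ [h1]] /= h2; rewrite /A_ /= /grid_up.
by rewrite ((grid_cellP N j (Z0 w)).1 h2).
Qed.

Let mA_piece N j : measurable ([set w | M (j.+1%:R / N.+1%:R) w = n] `&`
  Z t @^-1` grid_cell N j).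
Proof.
apply: measurableI; first by apply: measurable_state; rewrite divr_ge0.
by apply: mZB; exact: measurable_grid_cell.
Qed.

Let mA_ N : measurable (A_ N).
Proof. by rewrite A_E; apply: bigcup_measurable. Qed.

Let D N j : set (measurableTypeR R) := grid_cell N j `&` `]0, +oo[.

Let D_cup N : \bigcup_j D N j = `]0, +oo[.
Proof.
rewrite /D -setI_bigcupl grid_bigcup; apply/setIidPr => x /=.
by rewrite !in_itv/= !andbT; exact: ltW.
Qed.

Let mD N j : measurable (D N j).
Proof. by apply: measurableI; [exact: measurable_grid_cell|exact: measurable_itv]. Qed.

Let measurable_integrand_grid N :
  measurable_fun (`]0, +oo[ : set R) (fun x => pmf_at P M n (grid_up N x) * g x).
Proof.
apply: measurable_funM; last exact: measurable_funTS.
apply: measurable_funS (measurable_pmf_grid n N); first exact: measurable_itv.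
by move=> x /=; rewrite !in_itv/= !andbT; exact: ltW.
Qed.

Let PA_ N : P (A_ N) =
  (\int[lebesgue_measure]_(x in `]0%R, +oo[) (pmf_at P M n (grid_up N x) * g x)%:E)%E.
Proof.
rewrite A_E measure_bigcup//; last first.
  move=> i j _ _ [w [[_ wi] [_ wj]]].
  by apply: (@grid_trivIset R N i j) => //; exists (Z t w).
rewrite -(D_cup N) ge0_integral_bigcup//; last 3 first.
- by rewrite (D_cup N); apply/measurable_EFinP; exact: measurable_integrand_grid.
- by move=> x _; rewrite lee_fin mulr_ge0// pmf_ge0.
- move=> i j _ _ [x [[xi _] [xj _]]].
  by apply: (@grid_trivIset R N i j) => //; exists x.
under eq_eseriesl do rewrite in_setT.
apply: eq_eseriesr => j _.
have u0 : 0 <= j.+1%:R / N.+1%:R :> R by rewrite divr_ge0.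
rewrite [LHS](independent_states u0 (@measurable_grid_cell R N j)).
rewrite gZ; last exact: measurable_grid_cell.
rewrite -pmf_fineK// -ge0_integralZl//; last 4 first.
- exact: (mD N j).
- exact/measurable_EFinP/measurable_funTS.
- by move=> x _; rewrite lee_fin.
- by rewrite lee_fin pmf_ge0.
apply: eq_integral => x; rewrite inE => -[xj _]; rewrite -EFinM.
by rewrite /grid_up ((grid_cellP N j (grid_cell_ge0 xj)).1 xj).
Qed.

Let AA w : \forall N \near \oo, A_ N w <-> time_changed M Z t w = n.
Proof.
have := right_continuous_grid (Z0 w) (@rM w _ (Z0 w)).
by apply: filterS => N; rewrite /A_ /= => ->.
Qed.

Lemma measurable_time_changed : measurable [set w | time_changed M Z t w = n].
Proof. exact: (cvg_probability mA_ AA).1. Qed.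

(** Rounding [Z t] up to the grid makes the time-changed event a countable
    disjoint union of events [M u = n] and [Z t] in a given cell, for which
    independence gives the formula. Both sides pass to the limit as the mesh
    tends to 0, the paths of [M] being right-continuous. *)
Lemma pmf_time_changed : pmf_at P (time_changed M Z) n t =
  \int[lebesgue_measure]_(x in `]0, +oo[) (pmf_at P M n x * g x).
Proof.
have [_ h1] := cvg_probability mA_ AA.
have h2 : (\int[lebesgue_measure]_(x in `]0%R, +oo[)
      (pmf_at P M n (grid_up N x) * g x)%:E @[N --> \oo] -->
    \int[lebesgue_measure]_(x in `]0%R, +oo[) (pmf_at P M n x * g x)%:E)%E.
  apply: (@dominated_cvg _ _ _ lebesgue_measure `]0, +oo[ (@measurable_gt0 R)
    (fun N x => (pmf_at P M n (grid_up N x) * g x)%:E) _ (EFin \o g)) => //.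
  - by move=> N; apply/measurable_EFinP; exact: measurable_integrand_grid.
  - move=> x; rewrite itv0y => x0; apply: cvg_EFin; first exact: nearW.
    by apply: cvgM; [exact/pmf_grid/ltW|exact: cvg_cst].
  - exact: density_integrable.
  - move=> N x _; rewrite lee_fin normrM !ger0_norm ?pmf_ge0// ler_piMl//.
    exact/pmf_le1/ltW/grid_up_gt0.
have e1 : (fun N => fine (P (A_ N))) =
  (fun N => fine (\int[lebesgue_measure]_(x in `]0%R, +oo[)
    (pmf_at P M n (grid_up N x) * g x)%:E)%E).
  by apply/funext => N; rewrite PA_.
rewrite e1 in h1.
have h3 : (fine (\int[lebesgue_measure]_(x in `]0%R, +oo[)
    (pmf_at P M n (grid_up N x) * g x)%:E)%E @[N --> \oo] -->
    \int[lebesgue_measure]_(x in `]0, +oo[) (pmf_at P M n x * g x)).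
  apply: fine_cvg; rewrite /Rintegral fineK//.
  have mp : measurable_fun (`]0, +oo[ : set R) (fun x => pmf_at P M n x * g x).
    apply: measurable_funM; last exact: measurable_funTS.
    apply: measurable_funS (measurable_pmf n); first exact: measurable_itv.
    by move=> x /=; rewrite !in_itv/= !andbT; exact: ltW.
  apply: integrable_fin_num => //.
  apply: le_integrable density_integrable => //; first exact/measurable_EFinP.
  move=> x; rewrite itv0y => x0; rewrite lee_fin/= normrM !ger0_norm ?pmf_ge0// ler_piMl//.
  exact/pmf_le1/ltW.
exact: (cvg_unique _ h1 h3).
Qed.

End time_change.

End events.

(** * Behaviour at small times *)

Section small_time.
Context {R : realType}.
Notation mu := (@lebesgue_measure R).

Lemma linear_bound (F : R -> R) (l : R) :
  F h / h @[h --> 0^'+] --> l -> (forall x, 0 < x -> F x <= 1) ->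
  exists2 C, 0 <= C & forall x, 0 < x -> F x <= C * x.
Proof.
move=> /cvgrPdist_lt /(_ 1 ltr01) [e /= e0 he] F1.
exists (`|l| + 1 + e^-1); first by rewrite !addr_ge0// invr_ge0 ltW.
move=> x x0; have [xe|ex] := ltP x e.
  have xB : ball_ [eta Num.Def.normr] 0 e x.
    by rewrite /ball_/= sub0r normrN ger0_norm// ltW.
  have h1 : `|l - F x / x| < 1 := he x xB x0.
  have h2 : F x / x <= `|l| + 1.
    by move: h1; rewrite ltr_norml => /andP[+ _]; have := ler_norm l; lra.
  rewrite -[F x](divfK (lt0r_neq0 x0)) ler_pM2r//.
  by have : 0 <= e^-1 by [rewrite invr_ge0 ltW]; lra.
apply: le_trans (F1 x x0) _; apply: (@le_trans _ _ (e^-1 * x)).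
  by rewrite ler_pdivlMl// mulr1.
by rewrite ler_pM2r// lerDr addr_ge0.
Qed.

(** If [1 / s] were integrable, its integral over [(0, t)] would not depend on
    [t], by scaling; then the integral over [(1/2, 1)] would vanish. *)
Lemma inv_not_integrable (t : R) : 0 < t ->
  ~ mu.-integrable `]0, t[ (EFin \o (fun s => s^-1)).
Proof.
move=> t0 it; have [i1 _] := integrable_scaled t0 it.
have {it i1} i1 : mu.-integrable `]0, 1[ (EFin \o (fun v : R => v^-1)).
  have := integrable_scale t (measurable_0t 1) i1.
  congr (mu.-integrable _ _); apply/funext => v /=.
  by rewrite invfM mulrA divff ?gt_eqF// mul1r.
have h0 : 0 < 2^-1 :> R by rewrite invr_gt0.
have ih : mu.-integrable `]0, 2^-1[ (EFin \o (fun v : R => v^-1)).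
  apply: (integrableS (measurable_0t 1) (measurable_0t _) _ i1).
  by apply: subset_itvl; rewrite bnd_simp; lra.
have [_ e1] := integrable_scaled h0 ih.
have e2 : \int[mu]_(s in `]0, 2^-1[) s^-1 = \int[mu]_(s in `]0, 1[) s^-1.
  rewrite e1 -RintegralZl; [|exact: measurable_0t|].
    by apply: eq_Rintegral => v _; rewrite invfM mulrA divff ?mul1r ?gt_eqF.
  have := integrable_scale 2 (measurable_0t 1) i1.
  by congr (mu.-integrable _ _); apply/funext => v /=; rewrite invfM invrK.
have := @Rintegral_itvB R (fun v => v^-1) (BRight 0) (BLeft 1) 2^-1 i1.
rewrite -Rintegral_itv_bndo_bndc// e2 subrr => /(_ _ _)/esym e3.
have {}e3 : \int[mu]_(s in `]2^-1, 1[) s^-1 = 0.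
  by apply: e3; rewrite bnd_simp; lra.
have mh : measurable (`]2^-1, 1[ : set (measurableTypeR R)) by exact: measurable_itv.
have : \int[mu]_(s in `]2^-1, 1[) 1 <= \int[mu]_(s in `]2^-1, 1[) s^-1.
  apply: le_Rintegral => //.
  - apply/integrableP; split; first exact/measurable_EFinP.
    rewrite /= normr1 integral_cst// mul1e [ltLHS]lebesgue_measure_itv/=.
    by case: ifP => _; exact: ltry.
  - apply: (integrableS (measurable_0t 1) mh _ i1).
    by apply: subset_itvr; rewrite bnd_simp; lra.
  - move=> s; rewrite /= in_itv/= => /andP[s2 s1].
    by rewrite invf_ge1 ?ltW// (lt_trans h0).
have e12 : mu `]2^-1, 1[%classic = (1 - 2^-1)%:E.
  rewrite lebesgue_measure_itv/= lte_fin; case: ifP => [_|h]; first by rewrite EFinB.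
  by exfalso; move: h; lra.
have -> : \int[mu]_(s in `]2^-1, 1[) 1 = 1 * fine (mu `]2^-1, 1[%classic).
  exact: Rintegral_cst.
by rewrite e3 e12 /=; lra.
Qed.

End small_time.

Section process_bounds.
Context {d : measure_display} {T : measurableType d} {R : realType}.
Variable P : probability T R.

(** For [n <= k] this follows from the rate of jumps of amplitude [n], and for
    [n > k] the event is contained in that of a large jump. *)
Lemma gcp_pmf_linear k (lambda : 'I_k -> R) M n :
  generalized_counting_process P lambda M -> (0 < n)%N ->
  exists2 C, 0 <= C & forall x, 0 < x -> pmf_at P M n x <= C * x.
Proof.
move=> hM n0; have mM := gcp_measurable hM.
have [nk|kn] := leqP n k.
  have nk' : (n.-1 < k)%N by rewrite prednK.
  have := @gcp_rate _ _ _ _ _ _ _ hM (Ordinal nk').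
  rewrite /= prednK// => /linear_bound; apply.
  by move=> x /ltW; exact: pmf_le1.
have mE x (B : set nat) : 0 <= x -> measurable [set w | B (M x w)].
  by move=> x0; have := mM x x0 measurableT B; rewrite setTI; apply.
have [|C C0 hC] := linear_bound (gcp_large_jump hM).
  move=> x /ltW x0; have mB := mE x (fun j => (k < j)%N) x0.
  by rewrite -lee_fin fineK; [exact: probability_le1|exact: fin_num_measure].
exists C => // x x0; apply: le_trans (hC x x0).
have mA := mE x (fun j => j = n) (ltW x0).
have mB := mE x (fun j => (k < j)%N) (ltW x0).
apply: fine_le; [exact: fin_num_measure|exact: fin_num_measure|].
by apply: le_measure; rewrite ?inE// => w /= ->.
Qed.

(** Both processes start at 0 and are right-continuous, so the time-changed
    process is at 0 at time [1 / (N + 1)] with probability tending to 1; by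
    monotonicity this probability only increases at earlier times. *)
Lemma pmf_time_changed0_ge k (lambda : 'I_k -> R) (M : R -> T -> nat) a b Z :
  generalized_counting_process P lambda M -> gamma_subordinator P a b Z ->
  exists2 s0, 0 < s0 & forall s, 0 < s < s0 ->
    2^-1 <= pmf_at P (time_changed M Z) 0 s.
Proof.
move=> hM hZ.
have mM := gcp_measurable hM; have rM := gcp_right_continuous hM.
have rZ : right_continuous_paths Z := gs_right_continuous hZ.
have nZ : nondecreasing_paths Z := gs_nondecreasing hZ.
have nM : nondecreasing_paths (real_process M) := gcp_nondecreasing hM.
have Zpos s w : 0 <= s -> 0 <= Z s w.
  by move=> s0; rewrite -(gs_start hZ w); exact: nZ.
have mA s : 0 <= s -> measurable [set w | time_changed M Z s w = 0%N].
  move=> s0; apply: (measurable_time_changed P mM rM) => [|w]; last exact: Zpos.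
  exact: (gs_measurable hZ).
pose A_ N := [set w | time_changed M Z (N.+1%:R^-1) w = 0%N].
have sN (N : nat) : 0 < N.+1%:R^-1 :> R by rewrite invr_gt0.
have AA w : \forall N \near \oo, A_ N w <-> [set: T] w.
  have /cvgrPdist_lt /(_ 1 ltr01) [e /= e0 he] := rM w 0 (lexx 0).
  have M0 x : 0 <= x < e -> M x w = 0%N.
    move=> /andP[]; rewrite le_eqVlt => /predU1P[<- _|x0 xe].
      exact: (gcp_start hM).
    have xB : ball_ [eta Num.Def.normr] 0 e x.
      by rewrite /ball_/= sub0r normrN ger0_norm// ltW.
    have : `|real_process M 0 w - real_process M x w| < 1 := he x xB x0.
    rewrite /real_process (gcp_start hM) sub0r normrN ger0_norm//.
    by rewrite -[1]/(1%:R) ltr_nat ltnS leqn0 => /eqP.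
  have /cvgrPdist_lt /(_ e e0) [e' /= e'0 he'] := rZ w 0 (lexx 0).
  have : \forall N \near \oo, e'^-1 < N%:R by exact: nbhs_infty_gtr.
  apply: filterS => N hN; split=> // _; apply: M0; rewrite Zpos ?(ltW (sN N))//=.
  have h3 : N.+1%:R^-1 < e' by rewrite invf_plt ?posrE// (lt_trans hN)// ltr_nat.
  have xB : ball_ [eta Num.Def.normr] 0 e' (N.+1%:R^-1).
    by rewrite /ball_/= sub0r normrN ger0_norm// ltW.
  have : `|Z 0 w - Z (N.+1%:R^-1) w| < e := he' _ xB (sN N).
  by rewrite (gs_start hZ) sub0r normrN ger0_norm// Zpos// ltW.
have [_] := cvg_probability P (fun N => mA _ (ltW (sN N))) AA.
rewrite probability_setT /= => cv1.
have h2 : (2^-1 : R) < 1 by lra.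
have [N _ hN] := cvgr_gt _ cv1 _ h2.
exists (N.+1%:R^-1) => // s /andP[s0 sN'].
apply: (@le_trans _ _ (fine (P (A_ N)))); first exact/ltW/(hN N (leqnn N)).
apply: fine_le; [exact/fin_num_measure/mA/ltW|exact/fin_num_measure/mA/ltW|].
apply: le_measure; rewrite ?inE; [exact/mA/ltW|exact/mA/ltW|].
move=> w; rewrite /A_ /time_changed /= => h.
have Zle : Z s w <= Z N.+1%:R^-1 w by apply: nZ; exact: ltW.
have := nM w _ _ (Zpos s w (ltW s0)) Zle.
by rewrite /real_process ler_nat h leqn0 => /eqP.
Qed.

End process_bounds.

(** * The gamma density and its time coefficient *)

Section gamma_density.
Context {R : realType}.
Variables (a b : R).
Hypothesis a0 : 0 < a.
Hypothesis b0 : 0 < b.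

Lemma gamma_density_mellin_kernel x s : 0 < x ->
  gamma_density a b x s = a `^ (b * s) / Gamma (b * s) * mellin_kernel a 0 (b * s) x.
Proof.
by move=> x0; rewrite /gamma_density /mellin_kernel expr0 mul1r expRD /powR (gt_eqF x0) mulrA.
Qed.

Lemma gamma_density_ge0 x s : 0 < s -> 0 <= gamma_density a b x s.
Proof.
move=> s0; rewrite !mulr_ge0 ?powR_ge0 ?expR_ge0// invr_ge0 ltW// Gamma_gt0//.
exact: mulr_gt0.
Qed.

Lemma measurable_gamma_density s :
  measurable_fun setT (fun x => gamma_density a b x s).
Proof.
apply: measurable_funM.
  by apply: measurable_funM => //; exact: measurable_powR.
apply: measurableT_comp; first exact: measurable_expR.
by apply: measurableT_comp => //; exact: measurable_funM.
Qed.

Definition gamma_coeff (s : R) : R := a `^ (b * s) / Gamma (b * s).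

Lemma smooth_gamma_coeff : smooth 0 gamma_coeff.
Proof.
have u0 (s : R) : 0 < s -> 0 < b * s + 0 by move=> s0; rewrite addr0 mulr_gt0.
have sG := smooth_comp_affine u0 (@smooth_Gamma R).
have sV : smooth 0 (fun s => (Gamma (b * s + 0))^-1).
  by apply: smoothV sG => s /u0 h; rewrite gt_eqF// Gamma_gt0.
apply: (eq_smooth _ (smoothM (@smooth_expR R 0 (ln a * b)) sV)) => s s0.
by rewrite /gamma_coeff /powR (gt_eqF a0) addr0 (mulrC (b * s)) mulrA.
Qed.

(** The logarithmic derivative of the coefficient is where the digamma function
    of the equation comes from. *)
Lemma derive1_gamma_coeff s : 0 < s ->
  derive1 gamma_coeff s = b * (ln a - digamma (b * s)) * gamma_coeff s.
Proof.
move=> s0; have bs0 : 0 < b * s + 0 by rewrite addr0 mulr_gt0.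
have G0 : Gamma (b * s + 0) != 0 by rewrite gt_eqF// Gamma_gt0.
pose f := (fun y => expR ((b * ln a) * y + 0) * (Gamma (b * y + 0))^-1).
have cf : gamma_coeff = f.
  by apply/funext => y; rewrite /gamma_coeff /f !addr0 /powR (gt_eqF a0) (mulrAC b y).
have h1 := is_derive_comp_affine (is_derive_expR ((b * ln a) * s + 0)).
have h2 := @is_derive_inv R (fun y => Gamma (b * y + 0)) s _ G0
  (is_derive_comp_affine (smooth_is_derive (@smooth_Gamma R) bs0)).
rewrite cf (derive1_is_derive (is_derive_mul h1 h2)) /f /digamma !addr0.
by field; rewrite addr0 in G0.
Qed.

(** The same coefficient continued past 0: the factor [b s] comes from
    [Gamma (b s + 1) = b s * Gamma (b s)]. *)
Definition gamma_coeff_ext (s : R) : R :=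
  s * (b * (expR (ln a * b * s) / Gamma (b * s + 1))).

Lemma affine1_gt0 (s : R) : - b^-1 < s -> 0 < b * s + 1.
Proof. by move=> h; rewrite -ltrBlDr sub0r -ltr_pdivrMl// mulrN1. Qed.

Lemma smooth_gamma_coeff_div :
  smooth (- b^-1) (fun s => b * (expR (ln a * b * s) / Gamma (b * s + 1))).
Proof.
apply: smoothZ; apply: smoothM; first exact: smooth_expR.
have sG := smooth_comp_affine affine1_gt0 (@smooth_Gamma R).
by apply: smoothV sG => s /affine1_gt0 h; rewrite gt_eqF// Gamma_gt0.
Qed.

Lemma smooth_gamma_coeff_ext : smooth (- b^-1) gamma_coeff_ext.
Proof. by apply: smoothM; [exact: smooth_id|exact: smooth_gamma_coeff_div]. Qed.

Lemma gamma_coeff_extE s : 0 < s -> gamma_coeff_ext s = gamma_coeff s.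
Proof.
move=> s0; have bs0 : 0 < b * s by exact: mulr_gt0.
rewrite /gamma_coeff_ext /gamma_coeff GammaS// /powR (gt_eqF a0).
rewrite (mulrC (b * s) (ln a)) -(mulrA (ln a)).
by field; rewrite !gt_eqF// Gamma_gt0.
Qed.

Lemma mellin_kernelS x s : 0 < x ->
  mellin_kernel a 0 (b * s + 1) x = x * mellin_kernel a 0 (b * s) x.
Proof.
move=> x0; have xE : x = expR (ln x) by rewrite lnK// posrE.
rewrite /mellin_kernel !expr0 !mul1r [X in _ = X * _]xE -expRD.
by congr expR; ring.
Qed.

End gamma_density.

(** * The equation for an abstract linear operator in time *)

Section time_operator.
Context {R : realType}.
Notation mu := (@lebesgue_measure R).
Variables (a b e u : R) (p w c : R -> R) (Cq : R).
Hypothesis a0 : 0 < a.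
Hypothesis b0 : 0 < b.
Hypothesis u0 : forall s, u < s -> 0 < b * s + e.
Hypothesis ule0 : u <= 0.
Hypothesis sc : smooth u c.
Hypothesis cE : forall s, 0 < s -> c s = gamma_coeff a b s.
Let q x := p x * w x.
Hypothesis mq : measurable_fun (`]0, +oo[ : set R) q.
Hypothesis qC : forall x, 0 < x -> `|q x| <= Cq.
Hypothesis gE : forall x s, 0 < x -> 0 < s ->
  gamma_density a b x s = w x * (c s * mellin_kernel a 0 (b * s + e) x).
Variable pf : R -> R.
Hypothesis pfE : forall s, 0 < s ->
  pf s = \int[mu]_(x in `]0, +oo[) (p x * gamma_density a b x s).

Let phi i x s := c s * mellin_kernel a i (b * s + e) x.
Let Phi i s := c s * mellin a q i (b * s + e).

Let F t := (ln a - digamma (b * t)) * pf t.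

Lemma density_family i : family a b e u q (phi i) (Phi i).
Proof. exact: family_term. Qed.

Lemma smooth_phi i x : smooth u (phi i x).
Proof. exact: ((family_smooth a0 mq qC u0 (density_family i)).1 x). Qed.

Lemma smooth_Phi i : smooth u (Phi i).
Proof. exact: (family_smooth a0 mq qC u0 (density_family i)).2. Qed.

Lemma pf_Phi s : 0 < s -> pf s = Phi 0 s.
Proof.
move=> s0; have us : u < s := le_lt_trans ule0 s0.
rewrite pfE// -(family_integral a0 mq qC u0 (density_family 0) us).2.
by apply: eq_Rintegral => x; rewrite inE itv0y => x0; rewrite gE// mulrA.
Qed.

Lemma derive1_Phi0 s : 0 < s -> derive1 (Phi 0) s = b * F s + b * Phi 1 s.
Proof.
move=> s0; have us : u < s := le_lt_trans ule0 s0.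
have h := is_derive_mul (smooth_is_derive sc us)
  (is_derive_comp_affine (is_derive_mellin a0 mq qC 0 (u0 us))).
rewrite (derive1_is_derive h) (eq_derive1_gt cE s0) (derive1_gamma_coeff a0 b0 s0) -cE//.
rewrite /F pf_Phi// /Phi; ring.
Qed.

(** [F] solved from [derive1_Phi0]: this expression is smooth as far to the left
    as the coefficient [c], although the digamma function has a pole at 0. *)
Definition F_ext s := b^-1 * derive1 (Phi 0) s + -1 * Phi 1 s.

Lemma F_extE s : 0 < s -> F s = F_ext s.
Proof. by move=> s0; rewrite /F_ext derive1_Phi0//; field; rewrite gt_eqF. Qed.

Lemma smooth_F_ext : smooth u F_ext.
Proof.
apply: smoothD; last exact: (@smoothZ _ u (-1) _ (@smooth_Phi 1%N)).
exact: (@smoothZ _ u b^-1 _ (smooth_derive1 (@smooth_Phi 0%N))).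
Qed.

Section operator.
Variable L : (R -> R) -> R.
Hypothesis L_eq : forall f g, (forall s, 0 < s -> f s = g s) -> L f = L g.
Hypothesis LD : forall f g, smooth u f -> smooth u g ->
  L (fun s => f s + g s) = L f + L g.
Hypothesis LZ : forall k f, smooth u f -> L (fun s => k * f s) = k * L f.
Hypothesis L_family : forall phi Phi, family a b e u q phi Phi ->
  mu.-integrable `]0, +oo[ (EFin \o (fun x => q x * L (phi x))) /\
  \int[mu]_(x in `]0, +oo[) (q x * L (phi x)) = L Phi.

(** The equation of order 1 transported by an operator [L] that acts on
    functions of time, is linear on smooth functions, only depends on positive
    times, and commutes with the integral in [x]. The choices of [L] are the
    [m]-th derivative and the Riemann-Liouville derivative at a given time. *)
Lemma operator_equation :
  let H x := p x * ln x * L (gamma_density a b x) in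
  mu.-integrable `]0, +oo[ (EFin \o H) /\
  L (derive1 (Phi 0)) = b * L F + b * \int[mu]_(x in `]0, +oo[) H x.
Proof.
move=> H; have [i1 e1] := L_family (density_family 1).
have HE x : 0 < x -> H x = q x * L (phi 1 x).
  move=> x0; rewrite /H.
  rewrite (@L_eq _ (fun s => w x * phi 0 x s)); last by move=> s s0; rewrite gE.
  rewrite LZ; last exact: smooth_phi.
  rewrite (@L_eq (phi 1 x) (fun s => ln x * phi 0 x s)); last first.
    by move=> s s0; rewrite /phi /mellin_kernel expr1 expr0; ring.
  by rewrite LZ; [rewrite /q; ring|exact: smooth_phi].
split.
  apply: eq_integrable i1; first exact: measurable_gt0.
  by move=> x; rewrite inE itv0y => x0 /=; rewrite HE.
have -> : \int[mu]_(x in `]0, +oo[) H x = L (Phi 1).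
  by rewrite -e1; apply: eq_Rintegral => x; rewrite inE itv0y => /HE.
rewrite (L_eq F_extE) -LZ; last exact: smooth_F_ext.
rewrite -LZ; last exact: smooth_Phi.
rewrite -LD; last 2 first.
- exact: (@smoothZ _ u b _ smooth_F_ext).
- exact: (@smoothZ _ u b _ (@smooth_Phi 1%N)).
by apply: L_eq => s s0; rewrite -F_extE// derive1_Phi0.
Qed.

End operator.

End time_operator.

(** * The equation at integer and fractional order *)

Section cases.
Context {R : realType}.
Notation mu := (@lebesgue_measure R).
Variables (a b : R) (p pf : R -> R).
Hypothesis a0 : 0 < a.
Hypothesis b0 : 0 < b.
Hypothesis mp : measurable_fun (`]0, +oo[ : set R) p.
Hypothesis pfE : forall s, 0 < s ->
  pf s = \int[mu]_(x in `]0, +oo[) (p x * gamma_density a b x s).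

Let g := gamma_density a b.
Let F t := (ln a - digamma (b * t)) * pf t.

Section integer_order.
Hypothesis p1 : forall x, 0 < x -> `|p x| <= 1.
Variable m : nat.

Let H t x := p x * ln x * derive1n m (g x) t.

(** Here the weight is [p] itself, with exponent shift [e = 0]; the families
    are then smooth at positive times. *)
Lemma integer_order_equation :
  [/\ derivable_upto m F, forall x, 0 < x -> derivable_upto m (g x) &
      forall t, 0 < t -> mu.-integrable `]0, +oo[ (EFin \o H t)] /\
  derivable_upto m.+1 pf /\
  forall t, 0 < t -> derive1n m.+1 pf t =
    b * derive1n m F t + b * \int[mu]_(x in `]0, +oo[) H t x.
Proof.
have u0 (s : R) : 0 < s -> 0 < b * s + 0 by move=> s0; rewrite addr0 mulr_gt0.
pose w (x : R) := 1 : R.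
have mq : measurable_fun (`]0, +oo[ : set R) (fun x => p x * w x).
  by apply: measurable_funM => //; exact: measurable_cst.
have qC x : 0 < x -> `|p x * w x| <= 1 by move=> x0; rewrite mulr1 p1.
have gE (x s : R) : 0 < x -> 0 < s ->
    gamma_density a b x s = w x * (gamma_coeff a b s * mellin_kernel a 0 (b * s + 0) x).
  by move=> x0 s0; rewrite gamma_density_mellin_kernel// mul1r addr0.
have sc := smooth_gamma_coeff a0 b0.
have cE (s : R) : 0 < s -> gamma_coeff a b s = gamma_coeff a b s by [].
have sPhi := smooth_Phi a0 u0 sc mq qC (i := 0%N).
have pfPhi := pf_Phi a0 u0 (lexx 0) sc mq qC gE pfE.
have sF : smooth 0 F.
  apply: (eq_smooth _ (smooth_F_ext a0 u0 sc mq qC)) => s s0.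
  by rewrite -(F_extE a0 b0 u0 (lexx 0) sc cE mq qC gE pfE s0).
have spf : smooth 0 pf by apply: (eq_smooth _ sPhi) => s s0; rewrite pfPhi.
have sg x : 0 < x -> smooth 0 (g x).
  move=> x0; have h := @smoothZ _ 0 (w x) _ (smooth_phi a0 u0 sc mq qC (i := 0%N) (x := x)).
  by apply: (eq_smooth _ h) => s s0; rewrite -gE.
have core t (t0 : 0 < t) :=
  operator_equation a0 b0 u0 (lexx 0) sc cE mq qC gE pfE (L := fun f => derive1n m f t)
    (fun f h fh => eq_derive1n_gt m fh t0) (fun f h sf sh => derive1nD_gt m sf sh t0)
    (fun k f sf => derive1nZ_gt k m sf t0).
have fam t (t0 : 0 < t) phi Phi : family a b 0 0 (fun x => p x * w x) phi Phi ->
    mu.-integrable `]0, +oo[ (EFin \o (fun x => p x * w x * derive1n m (phi x) t)) /\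
    \int[mu]_(x in `]0, +oo[) (p x * w x * derive1n m (phi x) t) = derive1n m Phi t.
  move=> f; have [phi' [Phi' [f' d D]]] := family_derive1n a0 mq qC u0 m f.
  have [i1 e1] := family_integral a0 mq qC u0 f' t0.
  have -> : (fun x => p x * w x * derive1n m (phi x) t) =
      (fun x => p x * w x * phi' x t) by apply/funext => x; rewrite d.
  by rewrite D.
split; first split.
- exact: (sF m).
- by move=> x x0; exact: (sg x x0 m).
- by move=> t t0; exact: (core t t0 (fam t t0)).1.
split; first exact: (spf m.+1).
move=> t t0; rewrite -(core t t0 (fam t t0)).2 derive1Sn.
apply: (eq_derive1n_gt (u := 0)) => // s s0.
by apply: (eq_derive1_gt (u := 0)) => // y y0; rewrite pfPhi.
Qed.

End integer_order.

Section fractional_order.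
Variables (C alpha K : R) (m : nat).
Hypothesis pC : forall x, 0 < x -> `|p x| <= C * x.
Hypothesis alpha01 : 0 < alpha < 1.

Let H t x := p x * ln x * (K * derive1n m (fracI alpha (g x)) t).

Definition frac_derivable n (f : R -> R) :=
  (forall t, 0 < t -> mu.-integrable `]0, t[
     (EFin \o (fun s => f s / (t - s) `^ alpha))) /\
  derivable_upto n (fracI alpha f).

(** Here the weight is [p x / x], bounded by hypothesis; it shifts the exponent
    by [e = 1], so that the families are smooth for [s > - 1 / b]. One of the
    [m + 1] derivatives on the left is moved inside the integral by
    [derive1_fracI0], the coefficient being 0 at time 0. *)
Lemma fractional_order_equation :
  [/\ frac_derivable m F, forall x, 0 < x -> frac_derivable m (g x) &
      forall t, 0 < t -> mu.-integrable `]0, +oo[ (EFin \o H t)] /\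
  frac_derivable m.+1 pf /\
  forall t, 0 < t -> K * derive1n m.+1 (fracI alpha pf) t =
    b * (K * derive1n m (fracI alpha F) t) + b * \int[mu]_(x in `]0, +oo[) H t x.
Proof.
pose u := - b^-1.
have ult0 : u < 0 by rewrite oppr_lt0 invr_gt0.
have ule0 := ltW ult0.
have u0 : forall s : R, u < s -> 0 < b * s + 1 by exact: affine1_gt0.
pose w (x : R) := x^-1 : R.
have mq : measurable_fun (`]0, +oo[ : set R) (fun x => p x * w x).
  apply: measurable_funM => //; apply: open_continuous_measurable_fun.
    exact: open_gt0.
  move=> x; rewrite inE itv0y => x0; apply: continuousV; first by rewrite gt_eqF.
  exact: cvg_id.
have qC x : 0 < x -> `|p x * w x| <= C.
  move=> x0; rewrite normrM [`|w x|]ger0_norm ?invr_ge0 ?(ltW x0)//.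
  by rewrite ler_pdivrMr// pC.
have gE (x s : R) : 0 < x -> 0 < s ->
    gamma_density a b x s = w x * (gamma_coeff_ext a b s * mellin_kernel a 0 (b * s + 1) x).
  move=> x0 s0; rewrite gamma_density_mellin_kernel// gamma_coeff_extE//.
  rewrite mellin_kernelS// /gamma_coeff /w.
  by rewrite [in RHS]mulrCA mulKf// gt_eqF.
have sc : smooth u (gamma_coeff_ext a b) := smooth_gamma_coeff_ext b0.
have cE : forall s : R, 0 < s -> gamma_coeff_ext a b s = gamma_coeff a b s.
  exact: gamma_coeff_extE.
have sPhi := smooth_Phi a0 u0 sc mq qC (i := 0%N).
have pfPhi := pf_Phi a0 u0 ule0 sc mq qC gE pfE.
have scF := smooth_F_ext a0 u0 sc mq qC.
have FcF := F_extE a0 b0 u0 ule0 sc cE mq qC gE pfE.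
have frac n (f f1 : R -> R) : (forall s, 0 < s -> f1 s = f s) -> smooth u f ->
    frac_derivable n f1.
  move=> ff sf; split=> [t t0|].
    apply: eq_integrable (fracI_integrable alpha01 t0 sf ult0).
      exact: measurable_0t.
    by move=> s; rewrite inE itv0tE => /andP[s0 _] /=; rewrite ff.
  have -> : fracI alpha f1 = fracI alpha f by apply/funext => t; exact: fracI_eq.
  have h : smooth 0 (fracI alpha f) := smooth_fracI alpha01 ult0 sf.
  exact: (h n).
have sphi x := smooth_phi a0 u0 sc mq qC (i := 0%N) (x := x).
have sg x := @smoothZ _ u (w x) _ (sphi x).
have LD t (t0 : 0 < t) (f h : R -> R) : smooth u f -> smooth u h ->
    K * derive1n m (fracI alpha (fun s => f s + h s)) t =
    K * derive1n m (fracI alpha f) t + K * derive1n m (fracI alpha h) t.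
  move=> sf sh; rewrite -mulrDr; congr (_ * _).
  rewrite -(derive1nD_gt m (smooth_fracI alpha01 ult0 sf) (smooth_fracI alpha01 ult0 sh) t0).
  by apply: (eq_derive1n_gt (u := 0)) => // s s0; exact: (fracID alpha01 ult0 s0 sf sh).
have LZ t (t0 : 0 < t) (k : R) (f : R -> R) : smooth u f ->
    K * derive1n m (fracI alpha (fun s => k * f s)) t =
    k * (K * derive1n m (fracI alpha f) t).
  move=> sf; rewrite mulrCA; congr (_ * _).
  rewrite -(derive1nZ_gt k m (smooth_fracI alpha01 ult0 sf) t0).
  by apply: (eq_derive1n_gt (u := 0)) => // s s0; exact: (fracIZ alpha01 ult0 k s0 sf).
have Leq t (f h : R -> R) : (forall s, 0 < s -> f s = h s) ->
    K * derive1n m (fracI alpha f) t = K * derive1n m (fracI alpha h) t.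
  move=> fh; suff -> : fracI alpha f = fracI alpha h by [].
  by apply/funext => s; exact: fracI_eq.
have fam t (t0 : 0 < t) phi Phi : family a b 1 u (fun x => p x * w x) phi Phi ->
    mu.-integrable `]0, +oo[
      (EFin \o (fun x => p x * w x * (K * derive1n m (fracI alpha (phi x)) t))) /\
    \int[mu]_(x in `]0, +oo[) (p x * w x * (K * derive1n m (fracI alpha (phi x)) t)) =
    K * derive1n m (fracI alpha Phi) t.
  move=> f; have [i1 e1] := family_derive1n_fracI a0 b0 mq qC u0 ult0 alpha01 m t0 f.
  have i2 := integrable_scale K measurable_gt0 i1.
  have -> : (fun x => p x * w x * (K * derive1n m (fracI alpha (phi x)) t)) =
      (fun x => K * (p x * w x * derive1n m (fracI alpha (phi x)) t)).
    by apply/funext => x; rewrite mulrCA.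
  by split => //; rewrite RintegralZl// e1.
have core t (t0 : 0 < t) :=
  operator_equation a0 b0 u0 ule0 sc cE mq qC gE pfE
    (L := fun f => K * derive1n m (fracI alpha f) t)
    (Leq t) (LD t t0) (LZ t t0) (fam t t0).
split; first split.
- exact: (frac m _ _ FcF scF).
- by move=> x x0; apply: (frac m _ _ _ (sg x)) => s s0; exact: gE.
- by move=> t t0; exact: (core t t0).1.
split; first exact: (frac m.+1 _ _ pfPhi sPhi).
move=> t t0; rewrite -(core t t0).2 derive1Sn; congr (_ * _).
apply: (eq_derive1n_gt (u := 0)) => // s s0.
have -> : fracI alpha pf = fracI alpha
    (fun s => gamma_coeff_ext a b s * mellin a (fun x => p x * w x) 0 (b * s + 1)).
  by apply/funext => y; exact: fracI_eq.
apply: (derive1_fracI0 alpha01 ult0 sPhi _ s0).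
by rewrite /gamma_coeff_ext !mul0r.
Qed.

End fractional_order.

(** Near 0 the digamma function behaves like [- 1 / (b s)], so that [F] is
    bounded below by a multiple of [1 / s] as soon as [pf] is bounded away
    from 0. *)
Lemma F_kernel_not_integrable alpha s0 : 0 < s0 -> 0 <= alpha ->
  (forall s, 0 < s < s0 -> 2^-1 <= pf s) ->
  ~ mu.-integrable `]0, 1[ (EFin \o (fun s => F s / (1 - s) `^ alpha)).
Proof.
move=> s00 al0 hpf.
pose r s := b * (expR (ln a * b * s) / Gamma (b * s + 1)).
pose u := - b^-1.
have ult0 : u < 0 by rewrite oppr_lt0 invr_gt0.
have sr : smooth u r := smooth_gamma_coeff_div b0.
have r0 s : u < s -> 0 < r s.
  by move=> us; rewrite mulr_gt0// divr_gt0 ?expR_gt0// Gamma_gt0// affine1_gt0.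
have sV : smooth u (fun s => derive1 r s * (r s)^-1).
  apply: smoothM; first exact: smooth_derive1.
  by apply: smoothV sr => s us; rewrite gt_eqF// r0.
have [B hB] := smooth_bounded 1 sV ult0.
have B0 : 0 <= B by apply: le_trans (hB 0 _); rewrite ?normr_ge0// lexx ler01.
have psiE s : 0 < s -> b * (ln a - digamma (b * s)) = s^-1 + derive1 r s / r s.
  move=> sp; have us : u < s := lt_trans ult0 sp.
  have c0 : gamma_coeff_ext a b s != 0 by rewrite mulf_neq0// gt_eqF// r0.
  have h := derive1_gamma_coeff a0 b0 sp.
  rewrite -(eq_derive1_gt (gamma_coeff_extE a0 b0) sp) -(gamma_coeff_extE a0 b0 sp) in h.
  have hd := is_derive_mul (is_derive_id s (1 : R)) (smooth_is_derive sr us).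
  rewrite (derive1_is_derive hd) /gamma_coeff_ext -/(r s) in h.
  have rs : r s != 0 by rewrite gt_eqF// r0.
  have ss : s != 0 by rewrite gt_eqF.
  apply: (mulIf (mulf_neq0 ss rs)); rewrite -h; by field; rewrite ?ss ?rs.
(* Below the last bound, [1 / s] exceeds twice the regular part [r' / r] of the
   logarithmic derivative. *)
pose e := Num.min (Num.min s0 1) (2 * (B + 1))^-1.
have e0 : 0 < e by rewrite !lt_min s00 ltr01 invr_gt0 mulr_gt0// ltr_wpDl.
have lower s : 0 < s < e -> (4 * b)^-1 * s^-1 <= F s / (1 - s) `^ alpha.
  rewrite !lt_min => /andP[sp /andP[/andP[ss0 s1] sB]].
  have h1 : `|derive1 r s / r s| <= B by apply: hB; rewrite !ltW.
  have h2 : 2 * (B + 1) < s^-1.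
    by rewrite -[X in X < _]invrK ltf_pV2 ?posrE ?invr_gt0 ?mulr_gt0 ?ltr_wpDl.
  have h3 : 2^-1 * s^-1 <= b * (ln a - digamma (b * s)).
    by rewrite psiE//; move: h1; rewrite ler_norml => /andP[h1 _]; lra.
  have h4 : (2 * b)^-1 * s^-1 <= ln a - digamma (b * s).
    have -> : (2 * b)^-1 * s^-1 = b^-1 * (2^-1 * s^-1) by rewrite invfM mulrA (mulrC b^-1).
    by rewrite ler_pdivrMl.
  have h5 : 2^-1 <= pf s by apply: hpf; rewrite sp.
  have h6 : (4 * b)^-1 * s^-1 <= F s.
    have -> : (4 * b)^-1 * s^-1 = (2 * b)^-1 * s^-1 * 2^-1.
      by field; rewrite !gt_eqF.
    by apply: ler_pM => //; rewrite ?mulr_ge0 ?invr_ge0 ?mulr_ge0 ?ltW.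
  have p0 : 0 < (1 - s) `^ alpha by rewrite powR_gt0// subr_gt0.
  have p1 : (1 - s) `^ alpha <= 1.
    have e1 : (1 : R) `^ alpha = 1 by rewrite powR1.
    rewrite -[leRHS]e1; apply: ge0_ler_powR => //; rewrite ?nnegrE; lra.
  rewrite ler_pdivlMr//; apply: le_trans h6.
  by rewrite ler_piMr// ?mulr_ge0 ?invr_ge0 ?mulr_ge0 ?ltW.
move=> h; have e1 : e <= 1 by rewrite !ge_min lexx orbT.
have he : mu.-integrable `]0, e[ (EFin \o (fun s => F s / (1 - s) `^ alpha)).
  apply: (integrableS (measurable_0t 1) (measurable_0t e) _ h).
  by apply: subset_itvl; rewrite bnd_simp.
apply: (inv_not_integrable e0).
have b4 : 0 < 4 * b by rewrite mulr_gt0.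
have h4 := integrable_scale (4 * b) (measurable_0t e) he.
apply: le_integrable h4; first exact: measurable_0t.
- apply/measurable_EFinP; apply: open_continuous_measurable_fun; first exact: open_0t.
  move=> s; rewrite inE itv0tE => /andP[sp _]; apply: continuousV; first by rewrite gt_eqF.
  exact: cvg_id.
- move=> s; rewrite itv0tE => hs; have /andP[sp _] := hs.
  rewrite lee_fin ger0_norm ?invr_ge0 ?(ltW sp)//; apply: le_trans (ler_norm _).
  by rewrite -ler_pdivrMl// lower.
Qed.

End cases.

(** * Integer and fractional parts of the order, and the fractional equation *)

Section truncation.
Context {R : realType}.

Lemma truncn_sub1 (x : R) : 1 <= x -> Num.truncn x = (Num.truncn (x - 1)).+1.
Proof.
move=> x1; have x10 : 0 <= x - 1 by rewrite subr_ge0.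
have := truncn_itv x10; set m := Num.truncn (x - 1) => /andP[h1 h2].
have x0 : 0 <= x by exact: le_trans x1.
have := truncn_itv x0; set k := Num.truncn x => /andP[h3 h4].
apply/eqP; rewrite eqn_leq -(ltnS k) -(ltnS m.+1) -!(ltr_nat R); apply/andP; split.
- by rewrite -natr1; move: h2 h3; lra.
- by rewrite -natr1; move: h1 h4; lra.
Qed.

Lemma nat_sub1 (x : R) : 1 <= x -> (x - 1 \is a Num.nat) = (x \is a Num.nat).
Proof.
move=> x1; rewrite !natrEtruncn (truncn_sub1 x1) -natr1.
by rewrite -subr_eq0 -[in RHS]subr_eq0; congr (_ == 0); ring.
Qed.

Lemma frac_part01 (x : R) : 1 <= x -> x \isn't a Num.nat ->
  0 < x - (Num.truncn x)%:R < 1.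
Proof.
move=> x1 xn; have x0 : 0 <= x by exact: le_trans x1.
have /andP[h1 h2] := truncn_itv x0.
rewrite subr_gt0 lt_neqAle h1 andbT ltrBlDl natr1 h2 andbT.
by apply: contra xn => /eqP <-; exact: natr_nat.
Qed.

End truncation.

Unset Implicit Arguments.
Set Strict Implicit.
Set Printing Implicit Defensive.

Theorem proposition4p3 (d : measure_display) (T : measurableType d)
    (R : realType) (P : probability T R)
    (k : nat) (hk : (1 <= k)%N)
    (lambda : 'I_k -> R) (hlambda : forall i, 0 < lambda i)
    (a b : R) (ha : 0 < a) (hb : 0 < b)
    (Z : R -> T -> R) (hZ : gamma_subordinator P a b Z)
    (M : R -> T -> nat) (hM : generalized_counting_process P lambda M)
    (hMZ : independent_processes P (real_process M) Z)
    (gamma : R) (hgamma : 1 <= gamma) (n : nat) :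
  let g := gamma_density a b in
  let p := pmf_at P M in
  let pf := pmf_at P (time_changed M Z) in
  let F := fun t => (ln a - digamma (b * t)) * pf n t in
  let H := fun t x => p n x * ln x * RL_derive (gamma - 1) (g x) t in
  let rhs_defined :=
    [/\ RL_derivable (gamma - 1) F,
        forall x, 0 < x -> RL_derivable (gamma - 1) (g x) &
        forall t, 0 < t ->
          lebesgue_measure.-integrable `]0, +oo[ (EFin \o H t)] in
  ((0 < n)%N \/ gamma \is a Num.nat -> rhs_defined) /\
  (rhs_defined ->
     RL_derivable gamma (pf n) /\
     forall t, 0 < t ->
       RL_derive gamma (pf n) t =
         b * RL_derive (gamma - 1) F t +
         b * \int[lebesgue_measure]_(x in `]0, +oo[) H t x).
Proof.
move=> g p pf F H rhs_defined.
have mM := gcp_measurable hM; have rM := gcp_right_continuous hM.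
have mp : measurable_fun (`]0, +oo[ : set R) (p n).
  have h : measurable_fun (`[0, +oo[ : set R) (pmf_at P M n) := measurable_pmf P mM rM n.
  apply: measurable_funS h; first exact: measurable_itv.
  by move=> x /=; rewrite !in_itv/= !andbT; exact: ltW.
have p1 (x : R) : 0 < x -> `|p n x| <= 1.
  by move=> /ltW x0; rewrite ger0_norm ?pmf_ge0// pmf_le1.
have pfE (s : R) : 0 < s -> pf n s =
    \int[lebesgue_measure]_(x in `]0, +oo[) (p n x * gamma_density a b x s).
  move=> s0; apply: (pmf_time_changed mM rM (g := fun x => gamma_density a b x s)) => //.
  - exact/(gs_measurable hZ)/ltW.
  - by move=> w; rewrite -(gs_start hZ w); apply: (gs_nondecreasing hZ) => //; exact: ltW.
  - exact: measurable_gamma_density.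
  - by move=> x; exact: gamma_density_ge0.
  - by move=> B mB; exact: (gs_density hZ).
suff main : ((0 < n)%N \/ gamma \is a Num.nat -> rhs_defined /\
    (RL_derivable gamma (pf n) /\ forall t, 0 < t ->
       RL_derive gamma (pf n) t =
         b * RL_derive (gamma - 1) F t +
         b * \int[lebesgue_measure]_(x in `]0, +oo[) H t x)) /\
    (n = 0%N -> gamma \isn't a Num.nat -> ~ rhs_defined).
  have [main1 main2] := main; split; first by move=> /main1[].
  move=> hr; have [gn|gn] := boolP (gamma \is a Num.nat).
    by have [] := main1 (or_intror gn).
  have [n0|n0] := posnP n; first by case: (main2 n0 gn hr).
  by have [] := main1 (or_introl n0).
have tr := truncn_sub1 hgamma; have nn := nat_sub1 hgamma.
(* For fractional [gamma], [m.+1] and [m.+2] derivatives are taken on the two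
   sides, so that the exponent [alpha] of the kernel and the normalising value
   of [Gamma] are the same. *)
set m := Num.truncn (gamma - 1) in tr.
have [gn|gn] := boolP (gamma \is a Num.nat).
  split=> // _; rewrite /rhs_defined /H /RL_derivable /RL_derive nn gn tr -/m.
  exact: (integer_order_equation ha hb mp pfE p1 m).
have alpha01 := frac_part01 hgamma gn.
set alpha := gamma - _ in alpha01.
have ea : gamma - 1 + 1 - m.+1%:R = alpha by rewrite subrK /alpha tr.
have eb : gamma + 1 - m.+2%:R = alpha by rewrite /alpha tr -natr1; ring.
have ec : m.+2%:R - gamma = m.+1%:R - (gamma - 1) by rewrite -natr1; ring.
rewrite /rhs_defined /H /RL_derivable /RL_derive nn (negbTE gn) tr -/m.
rewrite /RL_integral /RL_kernel ea eb ec.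
split=> [[n0|//]|n0 _ [[hF _] _ _]].
  have [C _ hC] := gcp_pmf_linear hM n0.
  have pC (x : R) : 0 < x -> `|p n x| <= C * x.
    by move=> x0; rewrite ger0_norm ?pmf_ge0// hC.
  exact: (fractional_order_equation ha hb mp pfE _ m.+1 pC alpha01).
have [s0 s00 hs0] := pmf_time_changed0_ge hM hZ.
have hs (s : R) : 0 < s < s0 -> 2^-1 <= pf n s by rewrite n0; exact: hs0.
have /andP[al0 _] := alpha01.
exact: (F_kernel_not_integrable ha hb s00 (ltW al0) hs (hF 1 ltr01)).
Qed.
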